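(* (Cancellation Property) Let $M$ and $M'$ be real Bott manifolds. If $S^1\times M$ and $S^1\times M'$ are diffeomorphic, then $M$ and $M'$ are diffeomorphic.
   Context: A real Bott manifold of dimension $n$ is the total space $M_n$ of a sequence of $\mathbb{R}P^1$-bundles $M_n\to M_{n-1}\to\cdots\to M_1\to M_0=\{\text{a point}\}$ such that, for each $j=1,\dots,n$, $M_j\to M_{j-1}$ is the projective bundle of the Whitney sum of a real line bundle $L_{j-1}$ and the trivial real line bundle over $M_{j-1}$. Equivalently (up to diffeomorphism), it is $M(A)=(S^1)^n/G(A)$ for an $n\times n$ upper triangular matrix $A=(A^i_j)$ over $\mathbb{Z}/2=\{0,1\}$ with zero diagonal, where $G(A)$ is generated by the commuting involutions $a_i(z_1,\dots,z_n)=(z_1,\dots,z_{i-1},-z_i,z_{i+1}(A^i_{i+1}),\dots,z_n(A^i_n))$, with $z(0)=z$ and $z(1)=\bar z$ for $z\in S^1\subset\mathbb{C}$. *)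

(* Defs.v *)
From HB Require Import structures.
From mathcomp Require Import all_boot all_order all_algebra.
From mathcomp Require Import all_classical all_reals all_analysis.

Set Implicit Arguments.
Unset Strict Implicit.
Unset Printing Implicit Defensive.

Import Order.TTheory GRing.Theory Num.Theory.
Import numFieldNormedType.Exports.

Local Open Scope classical_set_scope.
Local Open Scope ring_scope.

Section Smooth.
Context {R : realType}.

(* Meant for U open.  Values of f outside U are irrelevant: continuity and
   directional derivatives at a point of U only depend on the germ of f. *)
Fixpoint Ck (k m n : nat) (U : set 'rV[R]_m) (f : 'rV[R]_m -> 'rV[R]_n)
    : Prop :=
  (forall x, U x -> {for x, continuous f}) /\
  match k with
  | 0 => True
  | k'.+1 => forall v : 'rV[R]_m,
      (forall x, U x -> derivable f x v) /\ Ck k' U (fun x => derive f x v)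
  end.

Definition Cinfty (m n : nat) (U : set 'rV[R]_m) (f : 'rV[R]_m -> 'rV[R]_n) :=
  forall k, Ck k U f.

End Smooth.

Section Manifolds.
Variable R : realType.

(* A partial homeomorphism, from the set cdom to the set cimg; both maps are
   total functions whose values elsewhere are junk. *)
Record chart (n : nat) (T : topologicalType) := Chart {
  cdom : set T;
  cimg : set 'rV[R]_n;
  cmap : T -> 'rV[R]_n;
  cinv : 'rV[R]_n -> T
}.

Definition is_chart (n : nat) (T : topologicalType) (c : chart n T) :=
  [/\ open (cdom c) /\ open (cimg c),
      forall x, cdom c x -> cimg c (cmap c x) /\ cinv c (cmap c x) = x,
      forall y, cimg c y -> cdom c (cinv c y) /\ cmap c (cinv c y) = y,
      forall x, cdom c x -> {for x, continuous (cmap c)} &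
      forall y, cimg c y -> {for y, continuous (cinv c)}].

Record chartedSpace (n : nat) := ChartedSpace {
  carrier :> topologicalType;
  atlas : set (chart n carrier)
}.

Definition is_manifold (n : nat) (M : chartedSpace n) :=
  [/\ hausdorff_space M, @second_countable M,
      forall c, atlas (c := M) c -> is_chart c,
      forall x : M, exists2 c, atlas (c := M) c & cdom c x &
      forall c d, atlas (c := M) c -> atlas (c := M) d ->
        Cinfty (cimg c `&` cinv c @^-1` cdom d) (cmap d \o cinv c)].

(* Meant for W open. *)
Definition smooth_on (m n : nat) (M : chartedSpace m) (N : chartedSpace n)
    (W : set M) (f : M -> N) :=
  (forall x, W x -> {for x, continuous f}) /\
  forall c d, atlas (c := M) c -> atlas (c := N) d ->
    Cinfty (cimg c `&` cinv c @^-1` (W `&` f @^-1` cdom d))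
           (cmap d \o f \o cinv c).

Definition smooth (m n : nat) (M : chartedSpace m) (N : chartedSpace n)
    (f : M -> N) := smooth_on setT f.

Definition diffeomorphic (m n : nat) (M : chartedSpace m)
    (N : chartedSpace n) :=
  exists (f : M -> N) (g : N -> M),
    [/\ smooth f, smooth g, cancel f g & cancel g f].

Definition local_diffeo (m n : nat) (M : chartedSpace m) (N : chartedSpace n)
    (f : M -> N) :=
  forall x : M, exists (W : set M) (g : N -> M),
    [/\ open W /\ W x, open (f @` W), smooth_on W f, smooth_on (f @` W) g &
        forall y, W y -> g (f y) = y].

Definition prod_chart (m n : nat) (S T : topologicalType)
    (c : chart m S) (d : chart n T) : chart (m + n) (S * T)%type :=
  Chart (cdom c `*` cdom d)
        [set y | cimg c (lsubmx y) /\ cimg d (rsubmx y)]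
        (fun z => row_mx (cmap c z.1) (cmap d z.2))
        (fun y => (cinv c (lsubmx y), cinv d (rsubmx y))).

Definition prod_space (m n : nat) (M : chartedSpace m) (N : chartedSpace n) :
    chartedSpace (m + n) :=
  ChartedSpace [set e : chart (m + n) (M * N)%type |
    exists c d, [/\ atlas (c := M) c, atlas (c := N) d & e = prod_chart c d]].

Definition unit_circle : set (R * R) := [set z | z.1 ^+ 2 + z.2 ^+ 2 = 1].

(* The complex number x + iy is the pair (x, y). *)
Definition S1 : topologicalType := set_type unit_circle.

Lemma expi_subproof (t : R) : (cos t, sin t) \in unit_circle.
Proof. by rewrite inE /unit_circle /= cos2Dsin2. Qed.

Definition expi (t : R) : S1 := SigSub (expi_subproof t).

Lemma S1opp_subproof (z : S1) : (- (sval z).1, - (sval z).2) \in unit_circle.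
Proof.
by case: z => -[x y] /= zP; rewrite inE /unit_circle /= !sqrrN; move/set_mem: zP.
Qed.

Definition S1opp (z : S1) : S1 := SigSub (S1opp_subproof z).

Lemma S1conj_subproof (z : S1) : ((sval z).1, - (sval z).2) \in unit_circle.
Proof.
by case: z => -[x y] /= zP; rewrite inE /unit_circle /= sqrrN; move/set_mem: zP.
Qed.

Definition S1conj (z : S1) : S1 := SigSub (S1conj_subproof z).

(* The atlas consists of all local inverses of t |-> exp(it). *)
Definition circle : chartedSpace 1 :=
  @ChartedSpace 1 S1 [set c | is_chart c /\
    forall t, cimg c t -> cinv c t = expi (t ord0 ord0)].

Definition torus_chart (n : nat) (c : 'I_n -> chart 1 S1) :
    chart n 'rV[S1]_n :=
  Chart [set z : 'rV[S1]_n | forall j, cdom (c j) (z ord0 j)]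
        [set y : 'rV[R]_n | forall j, cimg (c j) (const_mx (y ord0 j))]
        (fun z => \row_j cmap (c j) (z ord0 j) ord0 ord0)
        (fun y => \row_j cinv (c j) (const_mx (y ord0 j))).

Definition torus (n : nat) : chartedSpace n :=
  ChartedSpace [set e : chart n 'rV[S1]_n |
    exists2 c : 'I_n -> chart 1 S1,
      (forall j, atlas (c := circle) (c j)) & e = torus_chart c].

Definition upper_triangular0 (n : nat) (A : 'M['F_2]_n) :=
  forall i j : 'I_n, (j <= i)%N -> A i j = 0.

Definition conj_pow (z : S1) (a : 'F_2) : S1 :=
  if a == 0 then z else S1conj z.

Definition bott_invol (n : nat) (A : 'M['F_2]_n) (i : 'I_n) (z : torus n) :
    torus n :=
  \row_j (if (j < i)%N then z ord0 j
          else if j == i then S1opp (z ord0 j)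
          else conj_pow (z ord0 j) (A i j)).

(* The generators of G(A) are involutions, so that the elements of G(A) are
   the products of generators, without inverses. *)
Definition same_orbit (n : nat) (A : 'M['F_2]_n) (z w : torus n) :=
  exists s : seq 'I_n, w = foldr (bott_invol A) z s.

(* M is the quotient manifold (S^1)^n / G(A), with projection q. *)
Definition is_bott_quotient (n : nat) (A : 'M['F_2]_n) (M : chartedSpace n)
    (q : torus n -> M) :=
  [/\ local_diffeo q, forall p : M, exists z, q z = p &
      forall z w, q z = q w <-> same_orbit A z w].

Definition real_bott_manifold (n : nat) (M : chartedSpace n) :=
  is_manifold M /\
  exists A : 'M['F_2]_n, upper_triangular0 A /\
    exists q : torus n -> M, is_bott_quotient A q.

End Manifolds.

Arguments circle {R}.

(* Main.v *)
Require Import Defs.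
From mathcomp Require Import all_boot all_order all_algebra.
From mathcomp Require Import all_classical all_reals all_analysis.
From mathcomp Require Import perm ring lra zify.

(* Write M = R^n / G, where G is Z^n with the product k * l = k + eps(k) l,
   eps_j(k) = (-1)^((k A)_j), acting on R^n by x |-> eps(k) x + pi k; S^1 x M
   is then the quotient attached to the matrix 0 (+) A.  Lifting a
   homeomorphism S^1 x M -> S^1 x M' to the covers R^(n+1) gives an isomorphism
   of these groups, whose reduction mod 2 is an invertible matrix P over F_2.
   For each j the j-th coordinate is a twisted cocycle with values in Z; the
   twisted cocycles of G reduce mod 2 to combinations of the x_i with a fixed
   i-th column of A, up to a multiple of that column (these are the solutions
   of x^2 = a x in H^1(M; Z/2)).  This strong restriction on P survives the
   removal of the S^1 factor, by a Schur complement, once P_00 = 1 is arranged.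
   Conversely an invertible matrix satisfying it lifts to an affine map of R^n
   with unimodular linear part that intertwines the two group actions, and so
   descends to a diffeomorphism M -> M'. *)

Set Implicit Arguments.
Unset Strict Implicit.
Unset Printing Implicit Defensive.

Import Order.TTheory GRing.Theory Num.Theory.
Import numFieldNormedType.Exports.

Local Open Scope classical_set_scope.
Local Open Scope ring_scope.

(** * Bott groups and matrices over F_2 *)

(** A circle factor cannot be cancelled for flat manifolds in general: an isomorphism between Z x G
    and Z x G' need not respect the factors, and G and G' may differ. Here the relation kept between
    A, B and P is checked column by column and sees P only mod 2, so P may be altered with no group
    isomorphism behind it. This is what makes P_00 = 1 attainable: either P or its inverse has
    corner 1, or the elementary matrix E_00 is added to P. At the end an invertible P related in one
    direction is enough, since the affine map is built from P alone. The obstacle to the affine map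
    is equivariance: its linear part may send one coordinate into another only if the two carry the
    same sign character, and P has such a support only after multiples of the columns of P B are
    added to its columns. The translation part compensates for this change: conjugating y |-> -y by
    the translation by pi/2 gives y |-> -y + pi, an additional half period exactly where the sign is
    -1. *)

Lemma F2_cases (a : 'F_2) : a = 0 \/ a = 1.
Proof.
by case: a => [[|[|m]] // lt_m]; [left | right]; apply: val_inj.
Qed.

Lemma F2_addxx (a : 'F_2) : a + a = 0.
Proof. by case: (F2_cases a) => ->; apply: val_inj. Qed.

Lemma mx2_addxx m n (M : 'M['F_2]_(m, n)) : M + M = 0.
Proof. by apply/matrixP=> i j; rewrite !mxE F2_addxx. Qed.

Definition sg2 (R : pzRingType) (a : 'F_2) : R := if a == 0 then 1 else -1.

Lemma sg2_0 (R : pzRingType) : sg2 R 0 = 1.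
Proof. by rewrite /sg2 eqxx. Qed.

Lemma sg2_1 (R : pzRingType) : sg2 R 1 = -1.
Proof. by []. Qed.

Lemma sg2D (R : pzRingType) (a b : 'F_2) : sg2 R (a + b) = sg2 R a * sg2 R b.
Proof.
by case: (F2_cases a) => ->; case: (F2_cases b) => ->;
  rewrite ?addr0 ?add0r ?F2_addxx ?sg2_0 ?sg2_1 ?mulr1 ?mul1r ?mulrNN ?mulr1.
Qed.

Lemma intr_sg2 (R : pzRingType) (a : 'F_2) : (sg2 int a)%:~R = sg2 R a.
Proof. by case: (F2_cases a) => ->; rewrite ?sg2_0 ?sg2_1 // mulrN1z. Qed.

Lemma sg2_F2 (a : 'F_2) : sg2 'F_2 a = 1.
Proof. by case: (F2_cases a) => ->; rewrite ?sg2_0 ?sg2_1 //; apply: val_inj. Qed.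

Lemma intr_sg2_F2 (a : 'F_2) : (sg2 int a)%:~R = 1 :> 'F_2.
Proof. by rewrite intr_sg2 sg2_F2. Qed.

Lemma col_mulmx (R : pzSemiRingType) m n p (A : 'M[R]_(m, n)) (B : 'M[R]_(n, p)) j :
  col j (A *m B) = A *m col j B.
Proof. by rewrite !colE mulmxA. Qed.

Definition par m n (M : 'M[int]_(m, n)) : 'M['F_2]_(m, n) := map_mx intr M.

Lemma parD m n (k l : 'M[int]_(m, n)) : par (k + l) = par k + par l.
Proof. exact: map_mxD. Qed.

Lemma parM m n p (k : 'M[int]_(m, n)) (l : 'M[int]_(n, p)) :
  par (k *m l) = par k *m par l.
Proof. exact: map_mxM. Qed.

Lemma intr_F2_eq0 (x : int) : x%:~R = 0 :> 'F_2 -> exists y, x = 2 * y.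
Proof.
move=> /eqP; rewrite -(dvdz_pcharf (pchar_Fp (isT : prime 2))) => /dvdzP[y ->].
by exists y; rewrite mulrC.
Qed.

Lemma par_eq m n (k l : 'M[int]_(m, n)) :
  par k = par l -> exists h, l = h *+ 2 + k.
Proof.
move=> kl.
have [h hP] : exists h : 'M[int]_(m, n), forall i j, l i j - k i j = 2 * h i j.
  have E i j : exists y, l i j - k i j == 2 * y.
    have /intr_F2_eq0[y ->] : (l i j - k i j)%:~R = 0 :> 'F_2.
      by move/matrixP/(_ i j): kl; rewrite !mxE intrB => ->; rewrite subrr.
    by exists y.
  exists (\matrix_(i, j) xchoose (E i j)) => i j; rewrite mxE.
  exact/eqP/(xchooseP (E i j)).
exists h; apply/matrixP=> i j; move: (hP i j); rewrite mulr2n !mxE => E.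
by rewrite -[LHS](subrK (k i j)) E -mulr2n mulr_natl.
Qed.

Definition lift2 m n (M : 'M['F_2]_(m, n)) : 'M[int]_(m, n) :=
  map_mx (fun a : 'F_2 => (a != 0)%:Z) M.

Lemma lift2K m n (M : 'M['F_2]_(m, n)) : par (lift2 M) = M.
Proof.
apply/matrixP=> i j; rewrite !mxE.
by case: (F2_cases (M i j)) => ->; apply: val_inj.
Qed.

(* The fundamental group of the real Bott manifold of A, as 'rV[int]_m with
   the product read off from the action of the normal forms on 'rV[R]_m. *)
Section BottGroup.
Variables (m : nat) (A : 'M['F_2]_m).
Implicit Types k l : 'rV[int]_m.

(** The ring is a parameter because the same sign acts on Z in the group law and on the real line in
    the action. *)
Definition gsg (R : pzRingType) k j : R := sg2 R ((par k *m A) 0 j).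

Definition gmul k l : 'rV[int]_m := \row_j (k 0 j + gsg int k j * l 0 j).

Lemma par_gmul k l : par (gmul k l) = par k + par l.
Proof.
by apply/rowP=> j; rewrite !mxE intrD intrM intr_sg2_F2 mul1r.
Qed.

Lemma gsgM (R : pzRingType) k l j : gsg R (gmul k l) j = gsg R k j * gsg R l j.
Proof. by rewrite /gsg par_gmul mulmxDl mxE sg2D. Qed.

Lemma gmul_par0 k l : par k = 0 -> gmul k l = k + l.
Proof.
by move=> k0; apply/rowP=> j; rewrite !mxE /gsg k0 mul0mx mxE sg2_0 mul1r.
Qed.

Hypothesis Au : upper_triangular0 A.

Lemma gsg_delta (R : pzRingType) (c : int) i j :
  gsg R (c *: delta_mx 0 i) j = sg2 R (c%:~R * A i j).
Proof.
rewrite /gsg /par map_mxZ map_delta_mx -scalemxAl -rowE.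
by rewrite !mxE.
Qed.

Lemma gmul_delta_sq (c : int) i :
  gmul (c *: delta_mx 0 i) (c *: delta_mx 0 i) = (c *: delta_mx 0 i) *+ 2.
Proof.
apply/rowP=> j; rewrite !mxE gsg_delta eqxx /=.
by case: eqP => [->|]; rewrite ?mulr0 ?addr0 // Au // mulr0 sg2_0 mul1r.
Qed.

Section HomToF2.
Variables (p : nat) (psi : 'rV[int]_m -> 'rV['F_2]_p).
Hypothesis psiM : forall k l, psi (gmul k l) = psi k + psi l.

Let par2 k : par (k *+ 2) = 0.
Proof. by rewrite mulr2n parD mx2_addxx. Qed.

(** On even vectors [gmul] is addition, and the lattice they form is generated by the squares of the
    generators, which are [2 e_i] thanks to the zero diagonal. A target of exponent 2 kills
    squares. *)
Lemma hom_F2_double k : psi (k *+ 2) = 0.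
Proof.
have psi0 : psi 0 = 0.
  have : psi (gmul 0 0) = psi 0 + psi 0 by rewrite psiM.
  rewrite gmul_par0 ?addr0; last by rewrite /par map_mx0.
  by rewrite mx2_addxx.
have psi2D h l : psi ((h + l) *+ 2) = psi (h *+ 2) + psi (l *+ 2).
  by rewrite -psiM gmul_par0 // mulrnDl.
rewrite [k]row_sum_delta -sumrMnl.
rewrite (big_rec (fun x => psi x = 0)) // => i x _ IH.
by rewrite -gmul_par0 // psiM IH addr0 -gmul_delta_sq psiM mx2_addxx.
Qed.

Lemma hom_F2_par k l : par k = par l -> psi k = psi l.
Proof.
move=> /par_eq[h ->].
by rewrite -gmul_par0 // psiM hom_F2_double add0r.
Qed.

Lemma hom_F2_linear : exists P : 'M['F_2]_(m, p), forall k, psi k = par k *m P.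
Proof.
(* [lift2] is not additive, but its defect is even and hence invisible to [psi]. *)
pose chi v := psi (lift2 v).
have chiD v w : chi (v + w) = chi v + chi w.
  by rewrite -psiM; apply: hom_F2_par; rewrite par_gmul !lift2K.
have chi0 : chi 0 = 0.
  by have := chiD 0 0; rewrite addr0 mx2_addxx.
exists (\matrix_i chi (delta_mx 0 i)) => k.
have -> : psi k = chi (par k) by apply: hom_F2_par; rewrite lift2K.
rewrite mulmx_sum_row [in LHS](row_sum_delta (par k)).
rewrite (big_morph chi chiD chi0); apply: eq_bigr => i _.
rewrite rowK; case: (F2_cases (par k 0 i)) => ->; first by rewrite !scale0r.
by rewrite !scale1r.
Qed.

End HomToF2.

(* If x = t mod 2 for an a-twisted cocycle t, then up to a multiple of a the
   class x is a combination of the basis classes of the columns equal to a;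
   this is the relation x^2 = a x in the mod 2 cohomology ring. *)
Lemma twisted_cocycle_support (a x : 'cV['F_2]_m) (t : 'rV[int]_m -> int) :
  (forall k l, t (gmul k l) = t k + sg2 int ((par k *m a) 0 0) * t l) ->
  (forall k, (t k)%:~R = (par k *m x) 0 0) ->
  exists c, forall j, x j 0 + c * a j 0 != 0 -> col j A = a.
Proof.
move=> tM tx.
have t0 : t 0 = 0.
  have := tM 0 0; rewrite gmul_par0 ?addr0; last by rewrite /par map_mx0.
  by rewrite /par map_mx0 mul0mx mxE sg2_0 mul1r; lia.
pose e i : 'rV[int]_m := delta_mx 0 i.
have pe i (y : 'cV['F_2]_m) : (par (e i) *m y) 0 0 = y i 0.
  by rewrite /par map_delta_mx -rowE mxE.
have xe i : x i 0 = (t (e i))%:~R by rewrite tx pe.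
have pNe i (y : 'cV['F_2]_m) : (par (- e i) *m y) 0 0 = y i 0.
  rewrite /par map_mxN mulNmx mxE pe; case: (F2_cases (y i 0)) => ->;
  by apply: val_inj.
have tN i : t (- e i) = - (sg2 int (a i 0) * t (e i)).
  have := tM (- e i) (e i).
  have -> : gmul (- e i) (e i) = 0.
    apply/rowP=> j; rewrite !mxE -scaleN1r gsg_delta eqxx /=.
    by case: eqP => [->|]; rewrite ?mulr0 ?oppr0 ?addr0 // Au // mulr0 sg2_0 mul1r addNr.
  by rewrite t0 pNe; lia.
(* The relation e_i e_j = e_j^(+-1) e_i for i < j, with exponent given by [A i j], read through
   [t]. *)
have rel (i j : 'I_m) : (i < j)%N ->
    t (e i) + sg2 int (a i 0) * t (e j) =
    (if A i j == 0 then t (e j) else - (sg2 int (a j 0) * t (e j)))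
    + sg2 int (a j 0) * t (e i).
  move=> ij; have := tM (e i) (e j); rewrite pe => <-.
  have gsge h : gsg int (e i) h = sg2 int (A i h).
    by rewrite -[e i]scale1r gsg_delta mul1r.
  have nij : j != i by apply: contraTneq ij => ->; rewrite ltnn.
  case: (F2_cases (A i j)) => Aij; rewrite Aij /=.
    rewrite -[sg2 int (a j 0)](congr1 (sg2 int) (pe j a)) -tM; congr t.
    apply/rowP=> h; rewrite !mxE gsge -[e j]scale1r gsg_delta mul1r eqxx /=.
    case: (eqVneq h j) => [->|nhj]; last case: (eqVneq h i) => [->|nhi].
    - by rewrite Aij sg2_0 (negPf nij) /= mulr0; lia.
    - by rewrite (Au (ltnW ij)) sg2_0 mulr0; lia.
    - by rewrite !mulr0.
  rewrite -tN -[sg2 int (a j 0)](congr1 (sg2 int) (pNe j a)) -tM; congr t.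
  apply/rowP=> h; rewrite !mxE gsge -[- e j]scaleN1r gsg_delta eqxx /=.
  case: (eqVneq h j) => [->|nhj]; last case: (eqVneq h i) => [->|nhi].
  - by rewrite Aij sg2_1 (negPf nij) /= mulr0; lia.
  - by rewrite (Au (ltnW ij)) !mulr0 sg2_0; lia.
  - by rewrite !mulr0.
have F2int (b : int) : (b%:~R : 'F_2) != 0 -> b <> 0 by move=> h b0; rewrite b0 eqxx in h.
have [a0|] := eqVneq a 0.
  (* For the trivial twist, [A i j = 1] would give 2 t(e_j) = 0, impossible for an odd integer. *)
  exists 0 => j; rewrite mul0r addr0 xe => /F2int tj.
  apply/colP=> i; rewrite a0 !mxE.
  case: (ltnP i j) => ij; last exact: Au.
  move: (rel i j ij); rewrite a0 !mxE sg2_0.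
  by case: (F2_cases (A i j)) => -> //=; lia.
move=> /eqP an0.
have [h ah] : exists h, a h 0 = 1.
  case: (pickP (fun h => a h 0 != 0)) => [h ah|none].
    by exists h; case: (F2_cases (a h 0)) => // ah0; rewrite ah0 eqxx in ah.
  by case: an0; apply/colP=> i; rewrite mxE; move/negbFE/eqP: (none i).
have tconst j : a j 0 = 1 -> t (e j) = t (e h).
  move=> aj; case: (ltngtP j h) => [jh|hj|/val_inj->] //.
    by move: (rel j h jh); rewrite aj ah sg2_1; case: eqP; lia.
  by move: (rel h j hj); rewrite aj ah sg2_1; case: eqP; lia.
(* As [t] is constant on the support of [a], the class x + x_h a vanishes there. The multiple of [a]
   is the reduction of the cocycle k |-> (1 - (-1)^(k a)) / 2. Off the support, t(e_j) is nonzero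
   and [rel] forces [A i j = a i 0]. *)
exists (x h 0) => j.
case: (F2_cases (a j 0)) => aj; last first.
  by rewrite aj mulr1 !xe tconst // F2_addxx eqxx.
rewrite aj mulr0 addr0 xe => /F2int tj.
apply/colP=> i; rewrite !mxE.
case: (ltngtP i j) => [ij|ji|/val_inj->].
- move: (rel i j ij); rewrite aj sg2_0.
  case: (F2_cases (A i j)) => ->; case: (F2_cases (a i 0)) => -> //=;
  by rewrite ?sg2_0 ?sg2_1; lia.
- rewrite Au ?(ltnW ji) //.
  case: (F2_cases (a i 0)) => ai; rewrite ai //.
  move: (rel j i ji); rewrite aj ai sg2_0 sg2_1.
  by case: eqP; lia.
- by rewrite Au // aj.
Qed.

End BottGroup.

(* P describes a map of mod 2 classes in degree one, from those of B to those
   of A, compatible with the relations y_j^2 = (col j B) y_j. *)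
Definition compatible m (A B P : 'M['F_2]_m) :=
  forall j, exists c, forall i,
    P i j + c * (P *m B) i j != 0 -> col i A = col j (P *m B).

(** Coordinate [j] of [phi] is twisted by the pullback of the sign eps_j of [B], whose class is
    column [j] of [P *m B]. *)
Lemma hom_compatible m (A B : 'M['F_2]_m) (phi : 'rV[int]_m -> 'rV[int]_m)
    (P : 'M['F_2]_m) :
  upper_triangular0 A ->
  (forall k l, phi (gmul A k l) = gmul B (phi k) (phi l)) ->
  (forall k, par (phi k) = par k *m P) ->
  compatible A B P.
Proof.
move=> Au phiM phiP j.
have [] := twisted_cocycle_support (a := col j (P *m B)) (x := col j P)
  (t := fun k => phi k 0 j) Au.
- move=> k l; rewrite phiM mxE /gsg phiP -mulmxA -[in RHS]col_mulmx.
  by rewrite [in RHS]mxE.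
- by move=> k; rewrite -col_mulmx [RHS]mxE -phiP mxE.
by move=> c cP; exists c => i ci; apply: cP; rewrite !mxE; move: ci; rewrite !mxE.
Qed.

Lemma unit_F2_colP m (P : 'M['F_2]_m) (v w : 'cV['F_2]_m) :
  P \in unitmx -> P *m v = P *m w -> v = w.
Proof. by move=> Pu /(congr1 (mulmx (invmx P))); rewrite !mulKmx. Qed.

(** * Removing the circle factor from a compatible matrix *)

Section Cancellation.
Variables (n : nat) (A B : 'M['F_2]_n).
Hypothesis Bu : upper_triangular0 B.

Let A' : 'M['F_2]_(1 + n) := block_mx 0 0 0 A.
Let B' : 'M['F_2]_(1 + n) := block_mx 0 0 0 B.

Lemma upper_triangular0_block (M : 'M['F_2]_n) :
  upper_triangular0 M -> upper_triangular0 (block_mx 0 0 0 M : 'M['F_2]_(1 + n)).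
Proof.
move=> Mu i j; rewrite -[i]fintype.splitK -[j]fintype.splitK.
case: (fintype.split i) => {}i; case: (fintype.split j) => {}j /=;
  rewrite ?block_mxEul ?block_mxEur ?block_mxEdl ?block_mxEdr ?mxE //.
by rewrite leq_add2l; apply: Mu.
Qed.

Let col_block0 (M : 'M['F_2]_n) : col 0 (block_mx 0 0 0 M : 'M['F_2]_(1 + n)) = 0.
Proof.
apply/colP=> i; rewrite 2![LHS]mxE; case: splitP => // k _; rewrite [LHS]mxE;
by case: splitP => // l _; rewrite !mxE.
Qed.

Let col_block (M : 'M['F_2]_n) j :
  col (rshift 1 j) (block_mx 0 0 0 M : 'M['F_2]_(1 + n)) = col_mx 0 (col j M).
Proof. by rewrite block_mxEh colKr col_col_mx; congr col_mx; apply/colP=> i; rewrite !mxE. Qed.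

(* The first basis class goes to u with u_0 = 1, so it may be killed on both
   sides: the quotient map is a Schur complement. *)
Lemma schur_compatible (P : 'M['F_2]_(1 + n)) :
  P \in unitmx -> compatible A' B' P -> P 0 0 = 1 ->
  exists2 P1 : 'M['F_2]_n, P1 \in unitmx & compatible A B P1.
Proof.
move=> Pu PP P00.
pose r := ursubmx P; pose s := dlsubmx P; pose N := drsubmx P.
have PE : P = block_mx 1%:M r s N.
  rewrite -[P]submxK; congr block_mx; apply/matrixP=> i j; rewrite !ord1 !mxE eqxx.
  by rewrite -[RHS]P00; congr (P _ _); apply: val_inj.
exists (N - s *m r).
  move: Pu; rewrite !unitmxE PE.
  have -> : block_mx 1%:M r s N =
      block_mx 1%:M 0 s 1%:M *m block_mx 1%:M r 0 (N - s *m r).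
    rewrite mulmx_block !mul0mx !mulmx0 !mul1mx !mulmx1 !addr0.
    by rewrite addrC subrK.
  by rewrite det_mulmx det_lblock det_ublock !det1 !mul1r.
have PbE j : col (rshift 1 j) (P *m B') = P *m col_mx 0 (col j B).
  by rewrite col_mulmx col_block.
have Pcol (b : 'cV_n) : P *m col_mx 0 b = col_mx (r *m b) (N *m b).
  by rewrite PE mul_block_col !mulmx0 !add0r.
have P0B : col 0 (P *m B') = 0 by rewrite col_mulmx col_block0 mulmx0.
have PB0 i : (P *m B') i 0 = 0 by have /colP/(_ i) := P0B; rewrite !mxE.
(* Column 0 of [P *m B'] vanishes, so compatibility at index 0 concerns column 0 of [P] itself. *)
have sA i : s i 0 != 0 -> col i A = 0.
  move=> si; have [c /(_ (rshift 1 i))] := PP 0.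
  rewrite PB0 mulr0 addr0 P0B col_block => /(_ _)/eqP.
  rewrite col_mx_eq0 => H; apply/eqP; move: H => /(_ _)/andP[] //.
  move: si; rewrite /s !mxE; congr (P _ _ != 0); apply: val_inj; rewrite //=.
move=> j.
have [c cP] := PP (rshift 1 j); exists c => i.
have rj : P 0 (rshift 1 j) = r 0 j.
  by rewrite /r !mxE; congr (P _ _); apply: val_inj.
have Nij : P (rshift 1 i) (rshift 1 j) = N i j by rewrite /N !mxE.
have PBrj k : (P *m B') k (rshift 1 j) = col_mx (r *m col j B) (N *m col j B) k 0.
  by rewrite -Pcol -PbE [RHS]mxE.
(* If column [j] of [B] is zero, a nonzero entry of the Schur complement comes from [N i j] or from
   [s i 0], and either one forces column [i] of [A] to be zero. *)
have [b0|bn0] := eqVneq (col j B) 0.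
  have PB0' k : (P *m B') k (rshift 1 j) = 0.
    by rewrite PBrj b0 !mulmx0 col_mx0 mxE.
  have colPB : col j ((N - s *m r) *m B) = 0 by rewrite col_mulmx b0 mulmx0.
  have -> : ((N - s *m r) *m B) i j = 0.
    by have /colP/(_ i) := colPB; rewrite !mxE.
  rewrite colPB mulr0 addr0 !mxE big_ord1 => Hne.
  have [|sr0] := boolP (s i 0 == 0).
    move=> /eqP s0; move: Hne; rewrite s0 mul0r subr0 => Nne.
    have := cP (rshift 1 i); rewrite PB0' mulr0 addr0 PbE b0 col_mx0 mulmx0.
    rewrite col_block => /(_ Nne)/eqP; rewrite col_mx_eq0 => /andP[_ /eqP].
    done.
  exact: sA.
(* col j B' is a nonzero column of B', hence its image is one of A'. *)
have [k kP] : exists k, col k A' = col (rshift 1 j) (P *m B').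
  case: (pickP (fun i0 => P i0 (rshift 1 j) + c * (P *m B') i0 (rshift 1 j) != 0)).
    by move=> k /cP kP; exists k.
  (* Otherwise [P] would kill e_j + c b_j, whose coordinate [j] is 1 because [B] has zero
     diagonal. *)
  move=> none; have : col (rshift 1 j) (P + c *: (P *m B')) = 0.
    by apply/colP=> k; move: (none k) => /negbFE/eqP; rewrite !mxE.
  rewrite linearD linearZ /= PbE -[X in col _ X]mulmx1 col_mulmx.
  have -> : col (rshift 1 j) 1%:M = col_mx 0 (col j 1%:M) :> 'cV['F_2]_(1 + n).
    by rewrite -[1%:M]/(1%:M : 'M['F_2]_(1 + n)) (scalar_mx_block 1 n) block_mxEh
         colKr col_col_mx; congr col_mx; apply/colP=> i'; rewrite !mxE.
  rewrite scalemxAr -mulmxDr scale_col_mx add_col_mx => H.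
  have := unit_F2_colP Pu (etrans H (esym (mulmx0 _ P))).
  move=> /eqP; rewrite col_mx_eq0 => /andP[_ /eqP/colP/(_ j)].
  by rewrite !mxE eqxx Bu // mulr0 addr0.
(* The image is a column of [A'], and row 0 of [A'] is zero. *)
have rb0 : r *m col j B = 0.
  move: kP; rewrite PbE Pcol -[k]fintype.splitK; case: (fintype.split k) => {}k /=.
    rewrite [k]ord1 => /eqP.
    have -> : lshift n 0 = 0 :> 'I_(1 + n) by apply: val_inj.
    by rewrite col_block0 eq_sym col_mx_eq0 => /andP[/eqP].
  by rewrite col_block => /eq_col_mx[<-].
have an0 : col (rshift 1 j) (P *m B') != 0.
  apply: contra_neq bn0; rewrite PbE => H.
  have := unit_F2_colP Pu (etrans H (esym (mulmx0 _ P))).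
  by move=> /eqP; rewrite col_mx_eq0 => /andP[_ /eqP].
(* A nonzero [r 0 j] would make the zero column 0 of [A'] equal to the nonzero column [j] of
   [P *m B']. Hence the Schur complement does not change column [j] of [N]. *)
have rj0 : r 0 j = 0.
  apply/eqP/negPn/negP => rjn.
  have := cP 0; rewrite rj PBrj rb0.
  have -> : col_mx (0 : 'cV_1) (N *m col j B) (0 : 'I_(1 + n)) 0 = 0.
    have -> : 0 = lshift n 0 :> 'I_(1 + n) by apply: val_inj.
    by rewrite col_mxEu mxE.
  by rewrite mulr0 addr0 col_block0 => /(_ rjn) H; rewrite -H eqxx in an0.
have -> : (N - s *m r) i j = N i j by rewrite !mxE big_ord1 rj0 mulr0 subr0.
have colPB : col j ((N - s *m r) *m B) = N *m col j B.
  by rewrite col_mulmx mulmxBl -mulmxA rb0 mulmx0 subr0.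
have -> : ((N - s *m r) *m B) i j = (N *m col j B) i 0.
  by rewrite -colPB [RHS]mxE.
rewrite colPB => H; have := cP (rshift 1 i).
rewrite Nij PBrj col_mxEd PbE Pcol rb0 col_block => /(_ H).
by move=> /eq_col_mx[].
Qed.

End Cancellation.

(** The conclusion is symmetric in A and B, as is being diffeomorphic, so a corner entry 1 in either
    [P] or [Q] suffices; only the case of two zero corners needs a modification. *)
Lemma cancel_compatible n (A B : 'M['F_2]_n) (P Q : 'M['F_2]_(1 + n)) :
  upper_triangular0 A -> upper_triangular0 B ->
  let A' : 'M['F_2]_(1 + n) := block_mx 0 0 0 A in
  let B' : 'M['F_2]_(1 + n) := block_mx 0 0 0 B in
  P *m Q = 1%:M -> compatible A' B' P -> compatible B' A' Q ->
  exists P1 : 'M['F_2]_n, P1 \in unitmx /\ (compatible A B P1 \/ compatible B A P1).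
Proof.
move=> Au Bu A' B' PQ PP QQ.
have [Pu Qu] := mulmx1_unit PQ.
have [P0|] := eqVneq (P 0 0) 1.
  by have [P1 u1 c1] := schur_compatible Bu Pu PP P0; exists P1; split=> //; left.
have [Q0|] := eqVneq (Q 0 0) 1.
  by have [P1 u1 c1] := schur_compatible Au Qu QQ Q0; exists P1; split=> //; right.
move=> Q1 P1.
have Q0 : Q 0 0 = 0 by case: (F2_cases (Q 0 0)) Q1 => // ->; rewrite eqxx.
have P0 : P 0 0 = 0 by case: (F2_cases (P 0 0)) P1 => // ->; rewrite eqxx.
(* Adding [E] leaves [P *m B'] unchanged because [E *m B' = 0]. The one new nonzero entry is at the
   corner, where the columns to be compared, column 0 of [A'] and of [P *m B'], are both zero. *)
pose E : 'M['F_2]_(1 + n) := delta_mx 0 0.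
have B'0 j : B' 0 j = 0.
  rewrite -[j]fintype.splitK; have -> : 0 = lshift n 0 :> 'I_(1 + n) by apply: val_inj.
  by case: (fintype.split j) => k /=; rewrite ?block_mxEul ?block_mxEur mxE.
have B'c j : B' j 0 = 0.
  rewrite -[j]fintype.splitK; have -> : 0 = lshift n 0 :> 'I_(1 + n) by apply: val_inj.
  by case: (fintype.split j) => k /=; rewrite ?block_mxEul ?block_mxEdl mxE.
have A'c j : A' j 0 = 0.
  rewrite -[j]fintype.splitK; have -> : 0 = lshift n 0 :> 'I_(1 + n) by apply: val_inj.
  by case: (fintype.split j) => k /=; rewrite ?block_mxEul ?block_mxEdl mxE.
have EB : E *m B' = 0.
  apply/matrixP=> i j; rewrite !mxE big1 // => k _; rewrite mxE.
  by case: (eqVneq k 0) => [->|_]; rewrite ?B'0 ?mulr0 // andbF mul0r.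
have [] // := @schur_compatible _ A B Bu (P + E); last first.
- by move=> P2 u2 c2; exists P2; split=> //; left.
- by rewrite mxE P0 mxE eqxx add0r.
- move=> j; have [c cP] := PP j; exists c => i.
  rewrite mulmxDl EB addr0 mxE [E i j]mxE.
  have [->|j0] := eqVneq j 0; last by rewrite andbF addr0; apply: cP.
  have PBc k : (P *m B') k 0 = 0.
    by rewrite !mxE big1 // => l _; rewrite B'c mulr0.
  rewrite andbT PBc mulr0 addr0.
  have -> : col 0 (P *m B') = 0 by apply/colP=> k; rewrite mxE PBc mxE.
  have [->|i0] := eqVneq i 0.
    by move=> _; apply/colP=> k; rewrite mxE A'c mxE.
  rewrite addr0 => Pi0.
  have [c' /(_ i)] := PP 0; rewrite PBc mulr0 addr0 => /(_ Pi0) ->.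
  by apply/colP=> k; rewrite mxE PBc mxE.
(* Since [Q 0 0 = 0], EQ squares to zero, so (P + E) Q = 1 + EQ is its own inverse in characteristic
   2. *)
- have EQE : E *m Q *m E = 0.
    apply/matrixP=> i j; rewrite -mulmxA !mxE big1 // => k _; rewrite !mxE.
    case: (eqVneq k 0) => [->|_]; last by rewrite andbF mul0r.
    rewrite big1 ?mulr0 // => l _; rewrite mxE.
    by case: (eqVneq l 0) => [->|_]; rewrite ?Q0 ?mul0r ?mulr0.
  have : (P + E) *m (Q *m (1%:M + E *m Q)) = 1%:M.
    rewrite mulmxA mulmxDl PQ mulmxDr mulmx1 mulmxDl mul1mx mulmxA EQE mul0mx addr0.
    by rewrite -addrA mx2_addxx addr0.
  by move=> /mulmx1_unit[].
Qed.

(** * Integral lifts of invertible matrices over F_2 *)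

Lemma shear_unit n (B P : 'M['F_2]_n) (c : 'I_n -> 'F_2) :
  upper_triangular0 B -> P \in unitmx ->
  (\matrix_(i, j) (P i j + c j * (P *m B) i j)) \in unitmx.
Proof.
move=> Bu Pu.
(* The second factor, 1 + B diag(c), is unitriangular. *)
have -> : \matrix_(i, j) (P i j + c j * (P *m B) i j) =
    P *m (1%:M + \matrix_(i, j) (B i j * c j)).
  apply/matrixP=> i j; rewrite mulmxDr mulmx1 !mxE; congr (_ + _).
  by rewrite mulr_sumr; apply: eq_bigr => k _; rewrite mxE mulrC mulrA.
rewrite unitmx_mul Pu /= unitmxE -det_tr det_trig; last first.
  apply/is_trig_mxP => i j ij; rewrite !mxE Bu ?(ltnW ij) // mul0r addr0.
  by case: eqP ij => // ->; rewrite ltnn.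
rewrite big1 ?unitr1 // => i _.
by rewrite !mxE eqxx Bu // mul0r addr0.
Qed.

(* GL_n(Z) -> GL_n(F_2) is onto, also on the invertible matrices supported on
   the pairs of indices with equal labels. *)
Lemma unimodular_lift (T : eqType) n (a b : 'I_n -> T) (C : 'M['F_2]_n) :
  C \in unitmx -> (forall i j, C i j != 0 -> a i = b j) ->
  exists D : 'M[int]_n,
    [/\ D \in unitmx, par D = C & forall i j, D i j != 0 -> a i = b j].
Proof.
elim: n a b C => [|n IH] a b C Cu Cab.
  exists 1%:M; split; first by rewrite unitmx1.
    by apply/matrixP=> -[].
  by case.
have [i0 Ci0] : exists i0, C i0 0 = 1.
  case: (pickP (fun i => C i 0 != 0)) => [k ak|none].
    by exists k; case: (F2_cases (C k 0)) => // ak0; rewrite ak0 eqxx in ak.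
  have : col 0 C = 0.
    by apply/colP=> i; rewrite !mxE; move/negbFE/eqP: (none i).
  rewrite colE => /(congr1 (mulmx (invmx C))); rewrite mulKmx // mulmx0.
  by move/colP/(_ 0); rewrite !mxE eqxx.
pose s := tperm (0 : 'I_n.+1) i0.
pose C1 : 'M['F_2]_(1 + n) := row_perm s C.
have C1u : C1 \in unitmx by rewrite /C1 row_permE unitmx_mul unitmx_perm.
have C1E i j : C1 i j = C (s i) j by rewrite mxE.
pose a1 i := a (s i).
pose r := ursubmx C1; pose t := dlsubmx C1; pose N := drsubmx C1.
have C1B : C1 = block_mx 1%:M r t N.
  rewrite -[C1]submxK; congr block_mx; apply/matrixP=> i j; rewrite !ord1 !mxE eqxx.
  have -> : lshift n 0 = 0 :> 'I_(1 + n) by apply: val_inj.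
  by rewrite tpermL Ci0.
have C1L : C1 = block_mx 1%:M 0 t 1%:M *m block_mx 1%:M r 0 (N - t *m r).
  rewrite C1B mulmx_block !mul0mx !mulmx0 !mul1mx !mulmx1 !addr0.
  by rewrite addrC subrK.
have Su : N - t *m r \in unitmx.
  move: C1u; rewrite C1L !unitmxE.
  by rewrite det_mulmx det_lblock det_ublock !det1 !mul1r.
pose a2 i := a1 (rshift 1 i); pose b2 j := b (rshift 1 j).
have rE j : r 0 j != 0 -> a1 0 = b2 j.
  rewrite /r !mxE => h; apply: Cab; move: h; congr (C (s _) _ != 0).
  exact: val_inj.
have tE i : t i 0 != 0 -> a2 i = b 0.
  rewrite /t !mxE => h; apply: Cab; move: h; congr (C (s _) _ != 0).
  exact: val_inj.
have a1b : a1 0 = b 0 by apply: Cab; rewrite tpermL Ci0.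
have NE i j : N i j != 0 -> a2 i = b2 j.
  by rewrite /N !mxE => h; apply: Cab.
(* Labels are chained through the pivot: a_i = b_0 = a_0 = b_j. Hence the Schur complement respects
   them. *)
have trE i j : t i 0 * r 0 j != 0 -> a2 i = b2 j.
  rewrite mulf_eq0 negb_or => /andP[/tE -> /rE <-].
  by rewrite a1b.
have [|S [Sunit Spar SE]] := IH a2 b2 _ Su.
  move=> i j; rewrite mxE [X in _ + X]mxE [(t *m r) i j]mxE big_ord1.
  have [->|ne] := eqVneq (N i j) 0; last by move=> _; apply: NE.
  by rewrite add0r oppr_eq0; apply: trE.
(* The lower right block is chosen so that the Schur complement of [D1] is exactly [S], whence [D1]
   has the determinant of [S]. *)
pose D1 : 'M[int]_(1 + n) :=
  block_mx 1%:M (lift2 r) (lift2 t) (S + lift2 t *m lift2 r).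
have D1u : D1 \in unitmx.
  have -> : D1 = block_mx 1%:M 0 (lift2 t) 1%:M *m block_mx 1%:M (lift2 r) 0 S.
    rewrite mulmx_block !mul0mx !mulmx0 !mul1mx !mulmx1 !addr0.
    by rewrite addrC.
  by rewrite unitmxE det_mulmx det_lblock det_ublock !det1 !mul1r -unitmxE.
have D1par : par D1 = C1.
  rewrite C1B [LHS](map_block_mx intr) -!/(par _) parD parM !lift2K Spar subrK.
  by congr block_mx; apply/matrixP=> i j; rewrite !ord1 !mxE.
have lift2_neq0 p q (M : 'M['F_2]_(p, q)) i j : lift2 M i j != 0 -> M i j != 0.
  by rewrite mxE; case: (M i j =P 0).
have D1E i j : D1 i j != 0 -> a1 i = b j.
  rewrite -[i]fintype.splitK -[j]fintype.splitK.
  have z0 : lshift n 0 = 0 :> 'I_(1 + n) by apply: val_inj.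
  case: (fintype.split i) => {}i; case: (fintype.split j) => {}j /=; rewrite ?[i]ord1 ?[j]ord1 ?z0.
  - by move=> _.
  - by rewrite -z0 block_mxEur => /lift2_neq0/rE; rewrite z0.
  - by rewrite -z0 block_mxEdl => /lift2_neq0/tE; rewrite z0.
  - rewrite block_mxEdr !mxE big_ord1.
    have [->|ne] := eqVneq (S i j) 0; last by move=> _; apply: SE.
    rewrite add0r mulf_eq0 negb_or => /andP[/lift2_neq0 t1 /lift2_neq0 r1].
    by apply: trE; rewrite mulf_neq0.
exists (row_perm s D1); split.
- by rewrite row_permE unitmx_mul unitmx_perm.
- rewrite /par map_row_perm -/(par D1) D1par /C1 -row_permM tperm2.
  by apply/matrixP=> i j; rewrite mxE perm1.
- by move=> i j; rewrite mxE => /D1E; rewrite /a1 /s tpermK.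
Qed.

(** * Smooth maps between Euclidean spaces *)

Lemma near_eq_continuous (S T : topologicalType) (f g : S -> T) x :
  {near x, f =1 g} -> {for x, continuous f} -> {for x, continuous g}.
Proof.
move=> fg cf; rewrite /prop_for /continuous_at -(nbhs_singleton fg).
by apply: (cvg_trans _ cf); apply: near_eq_cvg.
Qed.

Section CkCalculus.
Context {R : realType}.

Lemma Ck_continuous k m n (U : set 'rV[R]_m) (f : 'rV[R]_m -> 'rV[R]_n) x :
  Ck k U f -> U x -> {for x, continuous f}.
Proof. by case: k => [|k] [cf _] /cf. Qed.

(** [derive] is a total function and every clause of [Ck] is pointwise, so the notion makes sense on
    a single point. This lets smoothness be proved on a neighbourhood that depends on the point. *)
Lemma Ck_pointwise k m n (U : set 'rV[R]_m) (f : 'rV[R]_m -> 'rV[R]_n) :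
  Ck k U f <-> forall x, U x -> Ck k [set x] f.
Proof.
elim: k f => [|k IH] f; split.
- by move=> [cf _] x Ux; split=> // _ ->; apply: cf.
- by move=> H; split=> // x Ux; have [+ _] := H _ Ux; apply.
- move=> [cf df] x Ux; split=> [_ ->|v]; first exact: cf.
  by have [dv /IH Cv] := df v; split=> [_ ->|]; [apply: dv|apply: Cv].
- move=> H; split=> [x Ux|v]; first by have [+ _] := H _ Ux; apply.
  split=> [x Ux|]; first by have [_ /(_ v)[+ _]] := H _ Ux; apply.
  by apply/IH => x Ux; have [_ /(_ v)[]] := H _ Ux.
Qed.

Lemma Ck_sub k m n (U V : set 'rV[R]_m) (f : 'rV[R]_m -> 'rV[R]_n) :
  U `<=` V -> Ck k V f -> Ck k U f.
Proof. by move=> UV /Ck_pointwise Cf; apply/Ck_pointwise => x /UV /Cf. Qed.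

Lemma CkS k m n (U : set 'rV[R]_m) (f : 'rV[R]_m -> 'rV[R]_n) :
  Ck k.+1 U f -> Ck k U f.
Proof.
elim: k f => [|k IH] f [cf df]; split=> // v.
by have [dv Cv] := df v; split=> //; apply: IH.
Qed.

Lemma eq_Ck k m n (U : set 'rV[R]_m) (f g : 'rV[R]_m -> 'rV[R]_n) :
  open U -> (forall x, U x -> f x = g x) -> Ck k U f -> Ck k U g.
Proof.
move=> oU; elim: k f g => [|k IH] f g fg [cf df].
all: have nfg x : U x -> {near x, f =1 g}
  by move=> Ux; apply: filterS (open_nbhs_nbhs (conj oU Ux)) => y /fg.
all: have cg x : U x -> {for x, continuous g}
  by move=> Ux; apply: near_eq_continuous (nfg x Ux) (cf x Ux).
  by split.
split=> // v; have [dv Cv] := df v; split.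
  by move=> x Ux; apply: near_eq_derivable (dv x Ux); apply: nfg.
by apply: IH Cv => x Ux; apply: near_eq_derive; apply: nfg.
Qed.

Lemma Ck_cst k m n (U : set 'rV[R]_m) (a : 'rV[R]_n) : Ck k U (fun=> a).
Proof.
elim: k a => [|k IH] a; first by split=> // x _; exact: cst_continuous.
split=> [x _|v]; first exact: cst_continuous.
split=> [x _|]; first exact: derivable_cst.
have -> : (fun x => derive (fun=> a) x v) = (fun=> 0 : 'rV[R]_n).
  by apply/funext => x; exact: derive_cst.
exact: IH.
Qed.

Lemma Ck_add k m n (U : set 'rV[R]_m) (f g : 'rV[R]_m -> 'rV[R]_n) :
  open U -> Ck k U f -> Ck k U g -> Ck k U (fun x => f x + g x).
Proof.
move=> oU; elim: k f g => [|k IH] f g [cf df] [cg dg].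
all: have c x : U x -> {for x, continuous (fun x => f x + g x)}
  by move=> Ux; exact: (cvgD (cf x Ux) (cg x Ux)).
  by split.
split=> // v; have [dfv Cfv] := df v; have [dgv Cgv] := dg v; split.
  by move=> x Ux; apply: derivableD; [apply: dfv|apply: dgv].
apply: (eq_Ck oU) (IH _ _ Cfv Cgv) => x Ux.
by rewrite [RHS](@deriveD _ _ _ f g) //; [apply: dfv|apply: dgv].
Qed.

Lemma Ck_sum k m n p (U : set 'rV[R]_m) (f : 'I_p -> 'rV[R]_m -> 'rV[R]_n) :
  open U -> (forall i, Ck k U (f i)) -> Ck k U (fun x => \sum_i f i x).
Proof.
move=> oU; elim: p f => [|p IH] f Cf.
  by apply: (eq_Ck oU) (Ck_cst k U 0) => x _; rewrite big_ord0.
apply: (eq_Ck oU) (Ck_add oU (Cf ord0) (IH (fun i => f (lift ord0 i)) _)).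
  by move=> x _; rewrite big_ord_recl.
by move=> i; apply: Cf.
Qed.

(** [Ck] only speaks of row vectors, so the scalar factor is a coordinate of a vector-valued map.
    This is the product needed for the terms of the chain rule. *)
Lemma Ck_scale k m n p (U : set 'rV[R]_m) (f : 'rV[R]_m -> 'rV[R]_p) i
    (g : 'rV[R]_m -> 'rV[R]_n) :
  open U -> Ck k U f -> Ck k U g -> Ck k U (fun x => f x ord0 i *: g x).
Proof.
move=> oU; elim: k f g => [|k IH] f g Cf Cg.
all: have c x : U x -> {for x, continuous (fun x => f x ord0 i *: g x)}
  by move=> Ux; apply: (cvgZ _ (Ck_continuous Cg Ux));
    apply: (cvg_comp f (fun M : 'rV_p => M ord0 i) (Ck_continuous Cf Ux));
    exact: coord_continuous.
  by split.
have Cf' := CkS Cf; have Cg' := CkS Cg.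
case: Cf => _ df; case: Cg => _ dg.
have fgE v x : U x ->
    derivable (fun x => f x ord0 i *: g x) x v /\
    'D_v (fun x => f x ord0 i *: g x) x =
      'D_v f x ord0 i *: g x + f x ord0 i *: 'D_v g x.
  move=> Ux; have [/(_ x Ux) dfv _] := df v; have [/(_ x Ux) dgv _] := dg v.
  have dfi : derivable (fun x => f x ord0 i) x v by move/derivable_mxP: dfv; apply.
  have dgj j : derivable (fun x => g x ord0 j) x v by move/derivable_mxP: dgv; apply.
  have fgj j : (fun x => f x ord0 i) * (fun x => g x ord0 j) =
      (fun x => (f x ord0 i *: g x) ord0 j) by apply/funext => y; rewrite mxE.
  have D : derivable (fun x => f x ord0 i *: g x) x v.
    by apply/derivable_mxP => a j; rewrite [a](ord1 a : a = ord0) -fgj; exact: derivableM.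
  split=> //; rewrite (derive_mx D) (derive_mx dfv) (derive_mx dgv).
  apply/rowP => j; rewrite !mxE.
  have E : 'D_v (fun x => (f x ord0 i *: g x) ord0 j) x =
      'D_v (fun x => f x ord0 i) x * g x ord0 j + f x ord0 i * 'D_v (fun x => g x ord0 j) x.
    by rewrite -fgj deriveM //= addrC /GRing.scale /= [X in X + _]mulrC.
  exact: E.
split=> // v; have [dfv Cfv] := df v; have [dgv Cgv] := dg v; split.
  by move=> x Ux; have [] := fgE v x Ux.
apply: (eq_Ck oU) (Ck_add oU (IH _ _ Cfv Cg') (IH _ _ Cf' Cgv)) => x Ux.
by have [_ ->] := fgE v x Ux.
Qed.

Lemma mean_value_from0 (phi dphi : R -> R) (d : R) :
  (forall t : R, `|t| <= `|d| -> is_derive t 1 phi (dphi t)) ->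
  exists2 t, `|t| <= `|d| & phi d - phi 0 = dphi t * d.
Proof.
move=> H.
have cphi (I : interval R) : (forall t, t \in I -> `|t| <= `|d|) ->
    {within [set` I], continuous phi}.
  by move=> HI; apply: derivable_within_continuous => t /HI /H[].
have [d0|d0] := leP 0 d.
  have I0 t : t \in `[0, d] -> `|t| <= `|d|.
    by rewrite in_itv /= => /andP[t0 td]; rewrite !ger0_norm.
  have [|t tI ->] := MVT_segment d0 _ (cphi _ I0) (df := dphi).
    by move=> t td; apply: H; apply: I0; apply: subset_itv_oo_cc td.
  by exists t; [exact: I0|rewrite subr0].
have I0 t : t \in `[d, 0] -> `|t| <= `|d|.
  by rewrite in_itv /= => /andP[t0 td]; rewrite !ler0_norm ?lerN2 // ltW.
have [|t tI E] := MVT_segment (ltW d0) _ (cphi _ I0) (df := dphi).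
  by move=> t td; apply: H; apply: I0; apply: subset_itv_oo_cc td.
exists t; first exact: I0.
by rewrite -opprB E sub0r mulrN opprK.
Qed.

(* Move from y to z by changing one coordinate at a time. *)
Lemma mean_value_box n (g : 'rV[R]_n -> R) (y z : 'rV[R]_n) :
  (forall (x : 'rV[R]_n) (i : 'I_n), (forall j, `|x ord0 j - y ord0 j| <= `|z ord0 j - y ord0 j|) ->
    derivable g x (delta_mx ord0 i)) ->
  exists xi : 'I_n -> 'rV[R]_n,
    (forall i j, `|xi i ord0 j - y ord0 j| <= `|z ord0 j - y ord0 j|) /\
    g z - g y = \sum_i (z ord0 i - y ord0 i) * 'D_(delta_mx ord0 i) g (xi i).
Proof.
move=> dg.
pose w (k : nat) : 'rV[R]_n := \row_j if (j < k)%N then z ord0 j else y ord0 j.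
have step (i : 'I_n) : exists xi : 'rV[R]_n,
    (forall j, `|xi ord0 j - y ord0 j| <= `|z ord0 j - y ord0 j|) /\
    g (w i.+1) - g (w i) = (z ord0 i - y ord0 i) * 'D_(delta_mx ord0 i) g xi.
  pose p t := t *: delta_mx ord0 i + w i.
  have pb t : `|t| <= `|z ord0 i - y ord0 i| ->
      forall j, `|p t ord0 j - y ord0 j| <= `|z ord0 j - y ord0 j|.
    move=> tb j; rewrite !mxE eqxx /=; case: (eqVneq j i) => [->|ji].
      by rewrite ltnn mulr1 addrK.
    by rewrite mulr0 add0r; case: ifP => // _; rewrite subrr normr0.
  have [|t tb E] := @mean_value_from0 (g \o p)
      (fun t => 'D_(delta_mx ord0 i) g (p t)) (z ord0 i - y ord0 i).
    move=> t tb; have dp := dg _ i (pb t tb).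
    have E : (fun h : R => h^-1 *: ((g \o p \o shift t) (h *: 1) - (g \o p) t))
           = (fun h : R => h^-1 *: ((g \o shift (p t)) (h *: delta_mx ord0 i) - g (p t))).
      apply/funext => h; congr (_ *: (g _ - _)).
      by rewrite /p /= [_%:A]mulr1 scalerDl addrA.
    by split; [move: dp|]; rewrite /derivable /derive E.
  exists (p t); split; first exact: pb.
  rewrite mulrC -E /=; congr (g _ - g _); apply/rowP => j; rewrite !mxE eqxx /=.
    case: (ltngtP j i) => [ji|ij|/val_inj->].
    - rewrite ltnS (ltnW ji) (_ : (j == i) = false) ?mulr0 ?add0r //.
      by apply: contraTF ji => /eqP ->; rewrite ltnn.
    - rewrite ltnS leqNgt ij /= (_ : (j == i) = false) ?mulr0 ?add0r //.
      by apply: contraTF ij => /eqP ->; rewrite ltnn.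
    - by rewrite ltnSn eqxx mulr1 subrK.
  by rewrite mul0r add0r.
have [xi xiP] := choice step.
exists xi; split; first by move=> i; case: (xiP i).
have <- : w n = z by apply/rowP => j; rewrite mxE ltn_ord.
have w0 : w 0%N = y by apply/rowP => j; rewrite mxE.
rewrite -[in LHS]w0 -(telescope_sumr (fun k => g (w k))) // big_mkord.
apply: eq_bigr => i _; rewrite (xiP i).2; congr ((_ - _) * _).
by rewrite mxE ltn_ord.
Qed.

Lemma cvg_sum_ord (T : Type) (F : set_system T) {FF : Filter F} (V : normedModType R) n
    (f : 'I_n -> T -> V) (a : 'I_n -> V) :
  (forall i, f i x @[x --> F] --> a i) ->
  \sum_i f i x @[x --> F] --> \sum_i a i.
Proof.
elim: n f a => [|n IH] f a fa.
  by under eq_cvg do rewrite big_ord0; rewrite big_ord0; exact: cvg_cst.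
under eq_cvg do rewrite big_ord_recl; rewrite big_ord_recl.
by apply: cvgD => //; apply: (IH (fun i => f (lift ord0 i))).
Qed.

(** The increment of [g] splits into partial derivatives at intermediate points, which tend to [y]
    along with [c h]; continuity of the partial derivatives at [y] then replaces total
    differentiability. *)
Lemma chain_rule_curve n (g : 'rV[R]_n -> R) (y w : 'rV[R]_n) (c : R -> 'rV[R]_n) :
  (\forall x \near y, forall i, derivable g x (delta_mx ord0 i)) ->
  (forall i, {for y, continuous (fun x => 'D_(delta_mx ord0 i) g x)}) ->
  c h @[h --> 0^'] --> y ->
  h^-1 *: (c h - y) @[h --> 0^'] --> w ->
  h^-1 * (g (c h) - g y) @[h --> 0^'] -->
    \sum_i w ord0 i * 'D_(delta_mx ord0 i) g y.
Proof.
move=> /nbhs_ballP[e /= e0 eP] cg cy cw.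
have : forall h, exists xi : 'I_n -> 'rV[R]_n, ball y e (c h) ->
    (forall i j, `|xi i ord0 j - y ord0 j| <= `|c h ord0 j - y ord0 j|) /\
    g (c h) - g y =
      \sum_i (c h ord0 i - y ord0 i) * 'D_(delta_mx ord0 i) g (xi i).
  (* The constant [y] is a default value for those [h] that are not close enough to 0. *)
  move=> h; have [yc|nyc] := pselect (ball y e (c h)); last by exists (fun=> y).
  have [xi xiP] : exists xi : 'I_n -> 'rV[R]_n,
    (forall i j, `|xi i ord0 j - y ord0 j| <= `|c h ord0 j - y ord0 j|) /\
    g (c h) - g y =
      \sum_i (c h ord0 i - y ord0 i) * 'D_(delta_mx ord0 i) g (xi i).
    apply: mean_value_box => x i xP; apply: eP; split=> // a j.
    rewrite (ord1 a); move: (yc) => [_ /(_ ord0 j)].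
    rewrite /ball /= distrC => /(le_lt_trans (xP j)).
    by rewrite distrC.
  by exists xi.
move=> /choice[xi xiP].
have cb e' : 0 < e' -> \forall h \near 0^', ball y e' (c h).
  by move=> e'0; exact: (cy _ (nbhsx_ballx y e' e'0)).
have cxi i : xi h i @[h --> 0^'] --> y.
  apply/cvg_ballP => e' e'0; near=> h.
  have yc : ball y e (c h) by near: h; exact: cb.
  have [_ yc'] : ball y e' (c h) by near: h; exact: cb.
  have [xiy _] := xiP h yc; split=> // a j.
  rewrite (ord1 a); move: (yc' ord0 j).
  rewrite /ball /= distrC => /(le_lt_trans (xiy i j)).
  by rewrite distrC.
have : \sum_i (h^-1 *: (c h - y)) ord0 i * 'D_(delta_mx ord0 i) g (xi h i)
    @[h --> 0^'] --> \sum_i w ord0 i * 'D_(delta_mx ord0 i) g y.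
  apply: cvg_sum_ord => i; apply: cvgM.
    apply: (cvg_comp _ (fun M : 'rV[R]_n => M ord0 i) cw).
    exact: coord_continuous.
  exact: (cvg_comp _ _ (cxi i) (cg i)).
move=> S; apply: (cvg_trans _ S); apply: near_eq_cvg; near=> h.
have yc : ball y e (c h) by near: h; exact: cb.
have [_ ->] := xiP h yc; rewrite mulr_sumr.
by apply: eq_bigr => i _; rewrite !mxE mulrA.
Unshelve. all: by end_near. Qed.

Lemma chain_rule m n p (U : set 'rV[R]_m) (V : set 'rV[R]_n)
    (f : 'rV[R]_m -> 'rV[R]_n) (g : 'rV[R]_n -> 'rV[R]_p) x v :
  open V -> Ck 1 U f -> Ck 1 V g -> U x -> V (f x) ->
  derivable (g \o f) x v /\
  'D_v (g \o f) x =
    \sum_i 'D_v f x ord0 i *: 'D_(delta_mx ord0 i) g (f x).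
Proof.
move=> oV [cf df] [_ dg] Ux Vfx.
have [/(_ x Ux) dfx _] := df v.
have gd i y : V y -> derivable g y (delta_mx ord0 i).
  by move=> Vy; have [/(_ y Vy)] := dg (delta_mx ord0 i).
have gj j y i : V y -> 'D_(delta_mx ord0 i) (fun z => g z ord0 j) y =
    'D_(delta_mx ord0 i) g y ord0 j.
  by move=> Vy; rewrite (derive_mx (gd _ _ Vy)) mxE.
have nV : \forall y \near f x, V y by exact: open_nbhs_nbhs (conj oV Vfx).
pose c h := f (h *: v + x).
have cc : c h @[h --> 0^'] --> f x.
  have c0 : c 0 = f x by rewrite /c scale0r add0r.
  rewrite -c0; apply: cvg_within_filter.
  apply: (@continuous_comp _ _ _ (fun h : R => h *: v + x) f).
    by apply: cvgD; [apply: cvgZr_tmp; exact: cvg_id|exact: cvg_cst].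
  by rewrite scale0r add0r; exact: cf.
have cw : h^-1 *: (c h - f x) @[h --> 0^'] --> 'D_v f x by exact: dfx.
have lim j : h^-1 * (g (c h) ord0 j - g (f x) ord0 j) @[h --> 0^'] -->
    \sum_i 'D_v f x ord0 i * 'D_(delta_mx ord0 i) (fun z => g z ord0 j) (f x).
  apply: (@chain_rule_curve _ (fun z => g z ord0 j)) => //.
    near=> y => i; have Vy : V y by near: y.
    by move: (gd i y Vy) => /derivable_mxP; apply.
  move=> i.
  apply: (@near_eq_continuous _ _ (fun y => 'D_(delta_mx ord0 i) g y ord0 j)).
    by near=> y; rewrite gj //; near: y.
  have [_ [cgi _]] := dg (delta_mx ord0 i).
  apply: (cvg_comp _ (fun M : 'rV_p => M ord0 j) (cgi _ Vfx)).
  exact: coord_continuous.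
have D : derivable (g \o f) x v.
  apply/derivable_mxP => a j; rewrite [a](ord1 a : a = ord0).
  by apply/cvg_ex; eexists; exact: lim.
split=> //; rewrite (derive_mx D); apply/rowP => j; rewrite mxE summxE.
transitivity (\sum_i 'D_v f x ord0 i * 'D_(delta_mx ord0 i) (fun z => g z ord0 j) (f x)).
  by apply/cvg_lim => //; exact: lim.
by apply: eq_bigr => i _; rewrite gj // mxE.
Unshelve. all: by end_near. Qed.

Lemma Ck_comp k m n p (U : set 'rV[R]_m) (V : set 'rV[R]_n)
    (f : 'rV[R]_m -> 'rV[R]_n) (g : 'rV[R]_n -> 'rV[R]_p) :
  open U -> open V -> (forall x, U x -> V (f x)) ->
  Ck k U f -> Ck k V g -> Ck k U (g \o f).
Proof.
move=> oU oV UV; elim: k p g => [|k IH] p g Cf Cg.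
all: have c x : U x -> {for x, continuous (g \o f)}
  by move=> Ux; apply: continuous_comp;
    [exact: Ck_continuous Cf Ux|exact: Ck_continuous Cg (UV _ Ux)].
  by split.
have C1 q r (W : set 'rV[R]_q) (h : 'rV[R]_q -> 'rV[R]_r) : Ck k.+1 W h -> Ck 1 W h.
  move=> [ch dh]; split=> // u.
  by have [dhu Chu] := dh u; split=> //; split=> // y Wy; exact: Ck_continuous Chu Wy.
split=> // v; split.
  by move=> x Ux; have [] := chain_rule v oV (C1 _ _ _ _ Cf) (C1 _ _ _ _ Cg) Ux (UV _ Ux).
have Cfk := CkS Cf.
have C' : Ck k U (fun x => \sum_i 'D_v f x ord0 i *: ('D_(delta_mx ord0 i) g \o f) x).
  apply: Ck_sum => // i; case: Cf => _ /(_ v)[_ Cfv].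
  case: Cg => _ /(_ (delta_mx ord0 i))[_ Cgi].
  by apply: Ck_scale => //; exact: IH.
apply: (eq_Ck oU) C' => x Ux.
by have [_ ->] := chain_rule v oV (C1 _ _ _ _ Cf) (C1 _ _ _ _ Cg) Ux (UV _ Ux).
Qed.

Lemma Ck_affine k m n (U : set 'rV[R]_m) (M : 'M[R]_(m, n)) (b : 'rV[R]_n) :
  Ck k U (fun x => x *m M + b).
Proof.
have cont (x : 'rV[R]_m) : {for x, continuous (fun x : 'rV[R]_m => x *m M + b)}.
  have cM : (x0 *m M) @[x0 --> x] --> x *m M.
    under eq_cvg do rewrite mulmx_sum_row.
    rewrite mulmx_sum_row; apply: (cvg_sum_ord (F := nbhs x)) => i; apply: cvgZr_tmp.
    exact: coord_continuous.
  exact: (cvgD cM (cvg_cst b)).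
have D (v x : 'rV[R]_m) :
    h^-1 *: (((fun x : 'rV[R]_m => x *m M + b) \o shift x) (h *: v) - (x *m M + b))
    @[h --> 0^'] --> v *m M.
  have C : v *m M @[_ --> (0 : R)^'] --> v *m M by exact: cvg_cst.
  apply: (cvg_trans _ C); apply: near_eq_cvg; near=> h.
  have h0 : h != 0 by near: h; exact: nbhs_dnbhs_neq.
  by rewrite /= mulmxDl -[_ + _ + b]addrA addrK -scalemxAl scalerA mulVf // scale1r.
case: k => [|k]; first by split=> // x _.
split=> // v; split; first by move=> x _; apply/cvg_ex; exists (v *m M); exact: D.
have -> : (fun x => 'D_v (fun x : 'rV[R]_m => x *m M + b) x) = fun=> v *m M.
  by apply/funext => x; apply/cvg_lim => //; exact: D.
exact: Ck_cst.
Unshelve. all: by end_near. Qed.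

End CkCalculus.

(** * The circle *)

Section Circle.
Context {R : realType}.
Local Notation S1 := (S1 R).

Lemma S1_eq (z w : S1) :
  (sval z).1 = (sval w).1 -> (sval z).2 = (sval w).2 -> z = w.
Proof.
move=> e1 e2; apply: val_inj => /=.
by move: e1 e2; case: (sval z) (sval w) => [a b] [c d] /= -> ->.
Qed.

Lemma sval_S1_continuous : continuous (fun z : S1 => sval z : R * R).
Proof. exact: initial_continuous. Qed.

Lemma S1_re_continuous : continuous (fun z : S1 => (sval z).1 : R).
Proof.
by move=> z; apply: (@continuous_comp _ _ _ (fun z : S1 => sval z : R * R) fst);
  [exact: sval_S1_continuous|exact: cvg_fst].
Qed.

Lemma S1_im_continuous : continuous (fun z : S1 => (sval z).2 : R).
Proof.
by move=> z; apply: (@continuous_comp _ _ _ (fun z : S1 => sval z : R * R) snd);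
  [exact: sval_S1_continuous|exact: cvg_snd].
Qed.

Lemma expi_continuous : continuous (@expi R).
Proof.
have c : continuous (fun t : R => (cos t, sin t)).
  move=> t; apply: (@cvg_pair _ _ _ _ (nbhs (cos t)) (nbhs (sin t)));
    [exact: continuous_cos|exact: continuous_sin].
move=> t U [? [[W oW <-]]] /= Wt WU; apply: (@filterS _ (nbhs t) _ _ _ (fun x => WU (expi x))).
exact: (c t W (open_nbhs_nbhs (conj oW Wt))).
Qed.

Lemma expiDpi t : expi (t + pi) = S1opp (expi t) :> S1.
Proof. by apply: S1_eq => /=; [exact: cosDpi|exact: sinDpi]. Qed.

Lemma expiN t : expi (- t) = S1conj (expi t) :> S1.
Proof. by apply: S1_eq => /=; [exact: cosN|exact: sinN]. Qed.

Lemma expiD2pin t n : expi (t + pi *+ 2 *+ n) = expi t :> S1.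
Proof. by apply: S1_eq => /=; rewrite periodicn //; [exact: cosD2pi|exact: sinD2pi]. Qed.

Lemma expiD2pi (t : R) (z : int) : expi (t + pi * (2 * z)%:~R) = expi t :> S1.
Proof.
have E (n : nat) : pi * (2 * n%:Z)%:~R = pi *+ 2 *+ n :> R.
  by rewrite intrM -!pmulrn mulrA mulr_natr mulr_natr.
case: (intP z) => [|n|n]; first by rewrite (_ : (2 * 0)%:~R = 0 :> R) ?mulr0 ?addr0.
  by rewrite E expiD2pin.
rewrite -[in RHS](subrK (pi * (2 * n.+1%:Z)%:~R) t) [in RHS]E expiD2pin.
by rewrite -E !intrM intrN !mulrN.
Qed.

Lemma expi_eq (t s : R) : expi t = expi s :> S1 -> exists z : int, t = s + pi * (2 * z)%:~R.
Proof.
move=> ts.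
have p2 : 0 < pi * 2 :> R by rewrite mulr_gt0 // pi_gt0.
pose z := Num.floor ((t - s) / (pi * 2)); exists z.
pose r := t - s - pi * (2 * z)%:~R.
suff : r = 0 by rewrite /r; lra.
have rE : r = t - s - pi * 2 * z%:~R by rewrite /r intrM mulrA.
have r0 : 0 <= r.
  rewrite rE subr_ge0 mulrC -ler_pdivlMr //; exact: floor_le_tmp.
have r2 : r < pi * 2.
  have := floorD1_gt ((t - s) / (pi * 2)); rewrite -/z ltr_pdivrMr // intrD rE.
  by lra.
have e : expi (s + r) = expi s :> S1.
  by rewrite -ts -[RHS](expiD2pi _ (- z)); congr expi; rewrite /r !intrM intrN; lra.
have [c si] : cos r = 1 /\ sin r = 0.
  have -> : r = (s + r) - s by lra.
  have [e1 e2] : cos (s + r) = cos s /\ sin (s + r) = sin s.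
    by split; [have := congr1 (fun z => (sval z).1) e|have := congr1 (fun z => (sval z).2) e].
  by rewrite cosB sinB e1 e2 -!expr2 cos2Dsin2 mulrC subrr.
(* On [0, pi] cosine is injective; on (pi, 2 pi) the sine does not vanish. *)
have [rp|rp] := leP r pi.
  by apply: cos_inj; rewrite ?in_itv /= ?lexx ?pi_ge0 ?r0 // c cos0.
have : 0 < sin (r - pi) by apply: sin_gt0_pi; rewrite subr_gt0 rp /=; lra.
by rewrite sinB si cospi sinpi; lra.
Qed.

(* The coordinates of exp(-i t0) z. *)
Definition rot_re (t0 : R) (z : S1) : R := (sval z).1 * cos t0 + (sval z).2 * sin t0.
Definition rot_im (t0 : R) (z : S1) : R := (sval z).2 * cos t0 - (sval z).1 * sin t0.
(** The branch of the argument centred at [t0], inverse to [expi] on the open half circle around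
    exp(i t0). Rotating first lets a single arctangent serve everywhere. *)
Definition rot_arg (t0 : R) (z : S1) : R := t0 + atan (rot_im t0 z / rot_re t0 z).

Lemma rot_re_expi t0 t : rot_re t0 (expi t) = cos (t - t0).
Proof. by rewrite /rot_re cosB. Qed.

Lemma rot_im_expi t0 t : rot_im t0 (expi t) = sin (t - t0).
Proof. by rewrite /rot_im sinB. Qed.

Lemma rot_sqr t0 z : rot_re t0 z ^+ 2 + rot_im t0 z ^+ 2 = 1.
Proof.
have zP : (sval z).1 ^+ 2 + (sval z).2 ^+ 2 = 1 by have := set_mem (svalP z).
transitivity (((sval z).1 ^+ 2 + (sval z).2 ^+ 2) * (cos t0 ^+ 2 + sin t0 ^+ 2)).
  by rewrite /rot_re /rot_im; ring.
by rewrite zP cos2Dsin2 mulr1.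
Qed.

Lemma rot_inj t0 z w : rot_re t0 z = rot_re t0 w -> rot_im t0 z = rot_im t0 w -> z = w.
Proof.
have E u : (sval u).1 = rot_re t0 u * cos t0 - rot_im t0 u * sin t0 /\
           (sval u).2 = rot_re t0 u * sin t0 + rot_im t0 u * cos t0.
  rewrite -[(sval u).1]mulr1 -[(sval u).2]mulr1 -(cos2Dsin2 t0) /rot_re /rot_im.
  by split; ring.
by move=> e1 e2; apply: S1_eq; [rewrite !(E _).1|rewrite !(E _).2]; rewrite e1 e2.
Qed.

Lemma rot_arg_expi t0 t : `|t - t0| < pi / 2 -> rot_arg t0 (expi t) = t.
Proof.
rewrite ltr_norml => H.
by rewrite /rot_arg rot_re_expi rot_im_expi -/(tan _) tanK ?in_itv //= subrKC.
Qed.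

Lemma expi_rot_arg t0 z : 0 < rot_re t0 z -> expi (rot_arg t0 z) = z.
Proof.
move=> z0; set a := rot_im t0 z; set b := rot_re t0 z.
have ca : 0 < cos (atan (a / b)).
  by rewrite cos_gt0_pihalf // atan_gtNpi2 atan_ltpi2.
have ta : sin (atan (a / b)) = a / b * cos (atan (a / b)).
  by rewrite -[X in X * cos _]atanK /tan divfK // gt_eqF.
have ba := rot_sqr t0 z; rewrite -/a -/b in ba.
have cb : cos (atan (a / b)) = b.
  apply/eqP; rewrite -(eqrXn2 (n := 2)) ?(ltW ca) ?(ltW z0) //.
  have := cos2Dsin2 (atan (a / b)); rewrite ta.
  set c := cos _; move=> E; apply/eqP.
  have : c ^+ 2 * (b ^+ 2 + a ^+ 2) = b ^+ 2 by rewrite -[RHS]mulr1 -E; field; rewrite gt_eqF.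
  by rewrite ba mulr1.
apply: (@rot_inj t0); rewrite ?rot_re_expi ?rot_im_expi /rot_arg addrC addKr -/a -/b ?cb //.
by rewrite ta cb divfK // gt_eqF.
Qed.

Lemma rot_re_continuous t0 : continuous (rot_re t0).
Proof.
by move=> z; exact: (cvgD (cvgMr_tmp (S1_re_continuous (x := z)))
  (cvgMr_tmp (S1_im_continuous (x := z)))).
Qed.

Lemma rot_im_continuous t0 : continuous (rot_im t0).
Proof.
by move=> z; exact: (cvgB (cvgMr_tmp (S1_im_continuous (x := z)))
  (cvgMr_tmp (S1_re_continuous (x := z)))).
Qed.

Lemma rot_arg_continuous t0 z : 0 < rot_re t0 z -> {for z, continuous (rot_arg t0)}.
Proof.
move=> z0.
have h : rot_im t0 w / rot_re t0 w @[w --> z] --> rot_im t0 z / rot_re t0 z.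
  exact: (cvgM (rot_im_continuous (x := z))
    (cvgV (lt0r_neq0 z0) (rot_re_continuous (x := z)))).
exact: (cvgD (cvg_cst t0) (cvg_comp _ (@atan R) h (@continuous_atan R _))).
Qed.

Lemma rot_re_gt0_open t0 : open [set z : S1 | 0 < rot_re t0 z].
Proof.
have -> : [set z : S1 | 0 < rot_re t0 z] = rot_re t0 @^-1` [set x | 0 < x] by [].
by apply: open_comp => [z _|]; [exact: rot_re_continuous|exact: open_gt].
Qed.

Lemma expi_surj (z : S1) : exists t, expi t = z.
Proof.
have zP : (sval z).1 ^+ 2 + (sval z).2 ^+ 2 = 1 by have := set_mem (svalP z).
suff [t0 /expi_rot_arg <-] : exists t0, 0 < rot_re t0 z by exists (rot_arg t0 z).
have [x0|x0|x0] := ltrgtP 0 (sval z).1.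
- by exists 0; rewrite /rot_re cos0 sin0 mulr1 mulr0 addr0.
- by exists pi; rewrite /rot_re cospi sinpi; lra.
- have [y0|y0|y0] := ltrgtP 0 (sval z).2.
  + by exists (pi / 2); rewrite /rot_re cos_pihalf sin_pihalf; lra.
  + by exists (- (pi / 2)); rewrite /rot_re cosN sinN cos_pihalf sin_pihalf; lra.
  + by move: zP; rewrite -x0 -y0 expr0n /= addr0 => /eqP; rewrite eq_sym oner_eq0.
Qed.

Definition circ_chart (t0 : R) : chart R 1 S1 :=
  Chart [set z : S1 | 0 < rot_re t0 z]
        [set y : 'rV[R]_1 | `|y ord0 ord0 - t0| < pi / 2]
        (fun z => const_mx (rot_arg t0 z))
        (fun y => expi (y ord0 ord0)).

Lemma rot_arg_near t0 z : `|rot_arg t0 z - t0| < pi / 2.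
Proof. by rewrite /rot_arg addrC addKr ltr_norml atan_gtNpi2 atan_ltpi2. Qed.

Lemma rot_re_expi_gt0 t0 t : `|t - t0| < pi / 2 -> 0 < rot_re t0 (expi t).
Proof. by rewrite rot_re_expi ltr_norml => /andP[a b]; apply: cos_gt0_pihalf; rewrite a. Qed.

Lemma const_mx1_continuous : continuous (fun x : R => const_mx x : 'rV[R]_1).
Proof.
move=> x; apply/cvg_ballP => e e0; near=> y; split=> // i j; rewrite !mxE.
by near: y; exact: (nbhsx_ballx x e e0).
Unshelve. all: by end_near. Qed.

Lemma circ_chart_atlas t0 : @atlas R 1 circle (circ_chart t0).
Proof.
split=> //; split=> /=.
- split; first exact: rot_re_gt0_open.
  have -> : [set y : 'rV[R]_1 | `|y ord0 ord0 - t0| < pi / 2] =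
    (fun y : 'rV[R]_1 => y ord0 ord0) @^-1` [set x | `|x - t0| < pi / 2] by [].
  apply: open_comp => [y _|]; first exact: coord_continuous.
  have -> : [set x : R | `|x - t0| < pi / 2] = ball t0 (pi / 2).
    by apply/seteqP; split=> x; rewrite /ball /= distrC.
  exact: ball_open.
- move=> z z0; rewrite !mxE; split; first exact: rot_arg_near.
  exact: expi_rot_arg.
- move=> y yt; split; first exact: rot_re_expi_gt0.
  by rewrite rot_arg_expi //; apply/rowP => i; rewrite !mxE !ord1.
- move=> z z0.
  apply: (@continuous_comp _ _ _ (rot_arg t0) (fun x : R => const_mx x : 'rV[R]_1)).
    exact: rot_arg_continuous.
  exact: const_mx1_continuous.
- move=> y _.
  apply: (@continuous_comp _ _ _ (fun y : 'rV[R]_1 => y ord0 ord0) (@expi R)).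
    exact: coord_continuous.
  exact: expi_continuous.
Qed.

End Circle.

(** * Real Bott manifolds as quotients of Euclidean space *)

Definition open_map (S T : topologicalType) (f : S -> T) :=
  forall x O, nbhs x O -> nbhs (f x) (f @` O).

Lemma open_map_comp (S T U : topologicalType) (f : S -> T) (g : T -> U) :
  open_map f -> open_map g -> open_map (g \o f).
Proof.
move=> of_ og x O /of_/og; apply: filterS => _ [_ [z Oz <-] <-].
by exists z.
Qed.

Section Torus.
Context {R : realType}.

Lemma expi_open_map : open_map (@expi R).
Proof.
move=> t O tO.
have t0 : 0 < rot_re t (expi t) by apply: rot_re_expi_gt0; rewrite subrr normr0 divr_gt0 ?pi_gt0.
have tt : rot_arg t (expi t) = t by rewrite rot_arg_expi // subrr normr0 divr_gt0 ?pi_gt0.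
have cO : \forall z \near expi t, O (rot_arg t z).
  by apply: (rot_arg_continuous t0); rewrite tt.
have gt0 : \forall z \near expi t, 0 < rot_re t z.
  exact: (open_nbhs_nbhs (conj (@rot_re_gt0_open R t) t0)).
apply: filterS2 cO gt0 => z Oz /expi_rot_arg z0.
by exists (rot_arg t z).
Qed.

Lemma expi_double_open_map : open_map (fun t : R => expi (t + t) : S1 R).
Proof.
apply: (@open_map_comp _ _ _ (fun t : R => t + t)); last exact: expi_open_map.
move=> t O tO.
have c : u / 2 @[u --> t + t] --> t.
  rewrite [X in _ --> X](_ : t = (t + t) / 2); last by field.
  exact: (cvgMr_tmp cvg_id).
have cO : \forall u \near t + t, O (u / 2) by exact: (c O tO).
by apply: filterS cO => u Ou; exists (u / 2) => //; field.
Qed.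

Definition expiv n (x : 'rV[R]_n) : torus R n := \row_j expi (x ord0 j).

Lemma expiv_continuous n : continuous (@expiv n).
Proof.
move=> x U [P xP PU].
exists (fun i j => @expi R @^-1` P i j) => [i j|y yP].
  apply: (@expi_continuous R (x i j)).
  by move: (xP i j); rewrite mxE (ord1 i).
by apply: PU => i j; rewrite mxE -[ord0](ord1 i); apply: yP.
Qed.

Lemma expiv_open_map n : open_map (@expiv n).
Proof.
move=> x O [P xP PO].
exists (fun i j => @expi R @` P i j) => [i j|y yP].
  by rewrite mxE -(ord1 i : i = ord0); apply: expi_open_map; apply: xP.
have /choice[f fP] : forall j, exists t, P ord0 j t /\ expi t = y ord0 j.
  by move=> j; have [t] := yP ord0 j; exists t.
exists (\row_j f j); last by apply/rowP => j; rewrite !mxE; case: (fP j).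
by apply: PO => i j; rewrite mxE (ord1 i); case: (fP j).
Qed.

Lemma expiv_surj n (z : torus R n) : exists x, expiv x = z.
Proof.
have /choice[f fP] : forall j, exists t, expi t = (z : 'rV_n) ord0 j.
  by move=> j; exact: expi_surj.
by exists (\row_j f j); apply/rowP => j; rewrite !mxE.
Qed.

Definition tchart n (x : 'rV[R]_n) : chart R n (torus R n) :=
  torus_chart (fun j => circ_chart (x ord0 j)).

Lemma tchart_atlas n (x : 'rV[R]_n) : atlas (c := torus R n) (tchart x).
Proof. by exists (fun j => circ_chart (x ord0 j)) => // j; exact: circ_chart_atlas. Qed.

Lemma tchart_cdom n (x : 'rV[R]_n) : cdom (tchart x) (expiv x).
Proof.
move=> j /=; rewrite mxE; apply: rot_re_expi_gt0.
by rewrite subrr normr0 divr_gt0 ?pi_gt0.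
Qed.

Lemma tchart_cinv n (x y : 'rV[R]_n) : cinv (tchart x) y = expiv y.
Proof. by apply/rowP => j; rewrite !mxE /= mxE. Qed.

Lemma tchart_cmapK n (x : 'rV[R]_n) : cmap (tchart x) (expiv x) = x.
Proof.
apply/rowP => j; rewrite !mxE rot_arg_expi //.
by rewrite subrr normr0 divr_gt0 ?pi_gt0.
Qed.

Lemma tchart_cdomK n (x : 'rV[R]_n) z :
  cdom (tchart x) z -> expiv (cmap (tchart x) z) = z.
Proof.
by move=> zP; apply/rowP => j; rewrite !mxE expi_rot_arg //; apply: zP.
Qed.

Lemma tchart_cimg n (x : 'rV[R]_n) : cimg (tchart x) x.
Proof. by move=> j /=; rewrite mxE subrr normr0 divr_gt0 ?pi_gt0. Qed.

End Torus.

(** * The action of the Bott group on Euclidean space *)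

Section Action.
Context {R : realType}.
Variables (m : nat) (A : 'M['F_2]_m).
Implicit Types k l : 'rV[int]_m.
Implicit Types x y : 'rV[R]_m.

Definition gact k x : 'rV[R]_m :=
  \row_j (gsg A R k j * x ord0 j + pi * (k ord0 j)%:~R).

Lemma gactM k l x : gact (gmul A k l) x = gact k (gact l x).
Proof.
apply/rowP => j; rewrite !mxE gsgM intrD intrM intr_sg2.
by rewrite /gsg; ring.
Qed.

Lemma gact0 x : gact 0 x = x.
Proof.
apply/rowP => j; rewrite !mxE /gsg /par map_mx0 mul0mx mxE sg2_0.
by rewrite mul1r mulr0 addr0.
Qed.

Lemma gact_dist k x y j :
  `|gact k x ord0 j - gact k y ord0 j| = `|x ord0 j - y ord0 j|.
Proof.
rewrite !mxE opprD addrACA subrr addr0 -mulrBr normrM.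
by case: (F2_cases ((par k *m A) 0 j)) => e; rewrite /gsg e ?sg2_0 ?sg2_1 ?normrN normr1 mul1r.
Qed.

Lemma gact_continuous k : continuous (gact k).
Proof.
move=> x U /= /nbhs_ballP[e /= e0 eU]; apply/nbhs_ballP; exists e => //= y [_ xy].
by apply: eU; split=> // i j; move: (xy i j); rewrite (ord1 i) /ball /= gact_dist.
Qed.

Hypothesis Au : upper_triangular0 A.

(** By induction on the coordinate: the sign eps_j depends only on the entries before [j], and once
    these agree the j-th coordinates differ by pi (k_j - l_j). The action is thus free, with orbits
    separated by pi in the sup norm. *)
Lemma gact_separated k l x :
  (forall j, `|gact k x ord0 j - gact l x ord0 j| < pi) -> k = l.
Proof.
move=> H.
suff E n : forall j : 'I_m, (j < n)%N -> k ord0 j = l ord0 j.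
  by apply/rowP => j; exact: (E m).
elim: n => // n IH j jn.
have gE : gsg A R k j = gsg A R l j.
  congr sg2; rewrite !mxE; apply: eq_bigr => i _; rewrite !mxE.
  have [ij|ji] := ltnP i j; last by rewrite Au // !mulr0.
  by congr (_%:~R * _); apply: IH; apply: leq_trans ij _.
have := H j; rewrite !mxE gE opprD addrACA subrr add0r -mulrBr -intrB.
rewrite normrM gtr0_norm ?pi_gt0 // gtr_pMr ?pi_gt0 // -intr_norm ltrz1.
by rewrite -[k 0 j](subrK (l 0 j)); lia.
Qed.

Lemma gact_free k l x : gact k x = gact l x -> k = l.
Proof.
by move=> e; apply: (@gact_separated _ _ x) => j; rewrite e subrr normr0 pi_gt0.
Qed.

Lemma expiv_gact_par k l x : par k = par l -> expiv (gact k x) = expiv (gact l x).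
Proof.
move=> kl; have [h E] := par_eq kl.
apply/rowP => j; rewrite !mxE /gsg -kl.
rewrite -[RHS](expiD2pi _ (- (h ord0 j))); congr expi.
by rewrite E mulr2n !mxE !(intrD, intrM, intrN); ring.
Qed.

Lemma bott_invol_expiv i x :
  bott_invol A i (expiv x) = expiv (gact (delta_mx 0 i) x).
Proof.
apply/rowP => j; rewrite !mxE eqxx /=.
rewrite -[delta_mx 0 i]scale1r gsg_delta mul1r.
case: ltngtP => [ji|ij|/val_inj ->].
- rewrite (_ : (j == i) = false); last by apply: contraTF ji => /eqP ->; rewrite ltnn.
  by rewrite Au ?(ltnW ji) // sg2_0 mul1r mulr0 addr0.
- rewrite (_ : (j == i) = false); last by apply: contraTF ij => /eqP ->; rewrite ltnn.
  rewrite mulr0 addr0 /conj_pow /sg2.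
  by case: eqP => _; rewrite ?mul1r // mulN1r expiN.
- by rewrite eqxx Au // sg2_0 mul1r mulr1 expiDpi.
Qed.

Lemma bott_word_expiv (s : seq 'I_m) x :
  exists2 k, par k = \sum_(i <- s) delta_mx 0 i &
    foldr (bott_invol A) (expiv x) s = expiv (gact k x).
Proof.
elim: s => [|i s [k kP /= ->]].
  by exists 0; rewrite ?gact0 // big_nil /par map_mx0.
exists (gmul A (delta_mx 0 i) k).
  by rewrite par_gmul kP big_cons /par map_delta_mx.
by rewrite bott_invol_expiv gactM.
Qed.

Lemma same_orbit_expiv x y :
  same_orbit A (expiv x) (expiv y) <-> exists k, y = gact k x.
Proof.
split=> [[s]|[k ->]].
  have [k _ ->] := bott_word_expiv s x => e.
  have /choice[h hP] : forall j, exists z : int, y ord0 j = gact k x ord0 j + pi * (2 * z)%:~R.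
    by move=> j; apply: expi_eq; move/rowP/(_ j): e; rewrite !mxE.
  (* An even vector acts as a pure translation, here by the periods that [expi] forgets. *)
  exists (gmul A (\row_j (2 * h j)) k).
  have h0 : par (\row_j (2 * h j)) = 0.
    by apply/rowP => j; rewrite !mxE intrM (_ : 2%:~R = 0 :> 'F_2) ?mul0r //; apply: val_inj.
  rewrite gactM; apply/rowP => j; rewrite hP [RHS]mxE /gsg h0 mul0mx !mxE sg2_0.
  by rewrite mul1r.
(* Each index with an odd entry is used once; the word then has the parity of [k], and elements of
   equal parity act alike on the torus. *)
pose s := [seq i <- enum 'I_m | par k 0 i != 0].
exists s; have [l lP ->] := bott_word_expiv s x.
apply: expiv_gact_par; rewrite lP big_filter big_enum_cond /= [LHS]row_sum_delta.
rewrite [RHS]big_mkcond; apply: eq_bigr => i _.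
by case: (F2_cases (par k 0 i)) => ->; rewrite ?eqxx ?scale0r ?scale1r.
Qed.

End Action.

(** * Bott manifolds and their products with a circle as quotients *)

Section Quotient.
Context {R : realType}.

Lemma local_diffeo_continuous m n (M : chartedSpace R m) (N : chartedSpace R n)
  (f : M -> N) : local_diffeo f -> continuous f.
Proof.
move=> fl x; have [W [g [[oW Wx] _ [cf _] _ _]]] := fl x.
exact: cf.
Qed.

Lemma local_diffeo_open_map m n (M : chartedSpace R m) (N : chartedSpace R n)
  (f : M -> N) : local_diffeo f -> open_map f.
Proof.
move=> fl x O xO; have [W [g [[oW Wx] ofW _ [cg _] gf]]] := fl x.
have fWx : (f @` W) (f x) by exists x.
have cO : \forall y \near f x, (W `&` O) (g y).
  apply: (cg _ fWx); rewrite gf //; apply: filterI => //.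
  exact: (open_nbhs_nbhs (conj oW Wx)).
have nW : \forall y \near f x, (f @` W) y by exact: (open_nbhs_nbhs (conj ofW fWx)).
apply: filterS2 cO nW => v [_ Og] [y Wy yv].
by exists y => //; move: Og; rewrite -yv gf.
Qed.

(** The covering R^m -> R^m / G as topological data. Even covering is not assumed: for upper
    triangular [A] it comes from openness and [gact_separated]. *)
Definition group_quotient m (A : 'M['F_2]_m) (X : topologicalType) (p : 'rV[R]_m -> X) :=
  [/\ continuous p, open_map p, forall z, exists x, p x = z &
      forall x y, p x = p y <-> exists k, y = gact A k x].

Lemma bott_group_quotient n (A : 'M['F_2]_n) (M : chartedSpace R n)
    (q : torus R n -> M) :
  upper_triangular0 A -> is_bott_quotient A q -> group_quotient A (q \o @expiv R n).
Proof.
move=> Au [ql qs qo]; split.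
- move=> x; apply: continuous_comp; first exact: expiv_continuous.
  exact: local_diffeo_continuous.
- apply: open_map_comp; first exact: expiv_open_map.
  exact: local_diffeo_open_map.
- by move=> z; have [w <-] := qs z; have [x <-] := expiv_surj w; exists x.
- by move=> x y; rewrite /= qo same_orbit_expiv.
Qed.

(* The angle is doubled because the group of 0 (+) A contains the translation
   of the first coordinate by pi. *)
Lemma circle_prod_group_quotient n (A : 'M['F_2]_n) (X : topologicalType)
    (p : 'rV[R]_n -> X) :
  group_quotient A p ->
  group_quotient (block_mx 0 0 0 A : 'M['F_2]_(1 + n))
    (fun x : 'rV[R]_(1 + n) =>
       (expi (lsubmx x ord0 ord0 + lsubmx x ord0 ord0) : S1 R, p (rsubmx x))).
Proof.
move=> [cp op sp fp].
(* Row and column 0 of the matrix are zero, so the group splits: the first coordinate is only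
   translated and does not affect the other signs. *)
have gl (k : 'rV[int]_(1 + n)) (x : 'rV[R]_(1 + n)) :
    gact (block_mx 0 0 0 A : 'M['F_2]_(1 + n)) k x =
    row_mx (lsubmx x + const_mx (pi * (lsubmx k ord0 ord0)%:~R))
           (gact A (rsubmx k) (rsubmx x)).
  apply/rowP => j; rewrite -[j]fintype.splitK; case: (fintype.split j) => {}j /=.
    rewrite row_mxEl !mxE /gsg -[par k]hsubmxK mul_row_block !mulmx0 addr0 row_mxEl mxE.
    by rewrite sg2_0 mul1r (ord1 j).
  rewrite row_mxEr !mxE /gsg -[par k]hsubmxK mul_row_block !mulmx0 !add0r row_mxEr.
  by rewrite /par map_rsubmx.
split.
- have cl : continuous (fun x : 'rV[R]_(1 + n) => lsubmx x ord0 ord0 : R).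
    have -> : (fun x : 'rV[R]_(1 + n) => lsubmx x ord0 ord0 : R) =
        (fun x => x ord0 (lshift n ord0)) by apply/funext => x; rewrite mxE.
    exact: coord_continuous.
  have ce : continuous (fun t : R => expi (t + t) : S1 R).
    move=> t; apply: (@continuous_comp _ _ _ (fun t : R => t + t) (@expi R)).
      exact: (cvgD cvg_id cvg_id).
    exact: expi_continuous.
  have c1 := fun x => continuous_comp (cl x) (ce _).
  have cr : continuous (fun x : 'rV[R]_(1 + n) => rsubmx x).
    by move=> x; exact: differentiable_continuous (differentiable_rsubmx _).
  have c2 := fun x => continuous_comp (cr x) (cp _).
  by move=> x; apply: (@cvg_pair _ _ _ _ _ _ _ _ _ _ _ (c1 x) (c2 x)).
- move=> x O [P xP PO].
  have nl : nbhs (expi (lsubmx x ord0 ord0 + lsubmx x ord0 ord0) : S1 R)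
      ((fun t : R => expi (t + t) : S1 R) @` P ord0 (lshift n ord0)).
    by apply: expi_double_open_map; rewrite mxE; exact: xP.
  have nr : nbhs (p (rsubmx x))
      (p @` [set y : 'rV[R]_n | forall j, P ord0 (rshift 1 j) (y ord0 j)]).
    apply: op; exists (fun i j => P ord0 (rshift 1 j)) => [i j|y yP j]; last exact: yP.
    by rewrite (ord1 i) mxE; exact: xP.
  exists ((fun t : R => expi (t + t) : S1 R) @` P ord0 (lshift n ord0),
          p @` [set y : 'rV[R]_n | forall j, P ord0 (rshift 1 j) (y ord0 j)]) => //.
  move=> [_ _] /= [[t Pt <-] [y Py <-]].
  exists (row_mx (const_mx t) y : 'rV_(1 + n)); last by rewrite row_mxKl row_mxKr mxE.
  apply: PO => i j; rewrite (ord1 i) -[j]fintype.splitK.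
  case: (fintype.split j) => {}j /=; first by rewrite row_mxEl mxE (ord1 j).
  by rewrite row_mxEr; exact: Py.
- move=> [z w]; have [t <-] := expi_surj z; have [y <-] := sp w.
  by exists (row_mx (const_mx (t / 2)) y); rewrite row_mxKl row_mxKr mxE; congr (expi _, _); field.
- move=> x y; split=> [e|[k ->]].
    have ex := congr1 fst e; have px := congr1 snd e.
    have [h hP] := expi_eq (esym ex); have [k kP] := (fp _ _).1 px.
    exists (row_mx (const_mx h) k); rewrite gl row_mxKl row_mxKr -kP.
    rewrite -[LHS]hsubmxK; congr row_mx; apply/rowP => j; rewrite (ord1 j).
    by rewrite [RHS]mxE !mxE; move: hP; rewrite intrM !mxE !(ord1 ord0); lra.
  rewrite gl row_mxKl row_mxKr; congr pair; last by apply/fp; exists (rsubmx k).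
  rewrite -[LHS](expiD2pi _ (lsubmx k ord0 ord0)); congr expi.
  by rewrite [in RHS]mxE !mxE intrM; ring.
Qed.

End Quotient.

(** * Lifting maps to the universal cover *)

Section Lifting.
Context {R : realType}.

(** [B] is relatively open and closed in the connected segment. The guard on [t'] keeps the
    endpoints from requiring information outside it. *)
Lemma locally_constant_segment (B : set R) :
  (forall t : R, 0 <= t <= 1 -> \forall t' \near t, 0 <= t' <= 1 -> B t' <-> B t) ->
  B 0 -> B 1.
Proof.
move=> lB B0.
have cA : connected (`[(0 : R), 1]%classic) by exact: segment_connected.
have AE (t : R) : (`[(0 : R), 1]%classic) t <-> 0 <= t <= 1 by rewrite /= in_itv.
have A01 : (`[(0 : R), 1]%classic) 0 /\ (`[(0 : R), 1]%classic) 1 by split; apply/AE; lra.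
suff : `[(0 : R), 1]%classic = `[0, 1]%classic `&` B.
  by move=> E; have := A01.2; rewrite E => -[].
apply/esym/cA.
- by exists 0; split=> //; exact: A01.1.
- exists [set t : R | 0 <= t <= 1 -> B t]°; first exact: open_interior.
  apply/seteqP; split=> [t [At Bt]|t [At It]]; split=> //.
    apply: filterS (lB t ((AE t).1 At)) => t' H /H; tauto.
  exact: (nbhs_singleton It ((AE t).1 At)).
- exists (~` [set t : R | 0 <= t <= 1 -> ~ B t]°).
    by apply: open_closedC; exact: open_interior.
  apply/seteqP; split=> [t [At Bt]|t [At It]]; split=> //.
    by move=> It; exact: (nbhs_singleton It ((AE t).1 At)).
  apply: contrapT => nB; apply: It.
  apply: filterS (lB t ((AE t).1 At)) => t' H /H; tauto.
Qed.

Lemma norm_lt_near d (x : 'rV[R]_d) (r : R) : `|x| < r -> \forall x' \near x, `|x'| < r.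
Proof.
move=> xr; have O : open ((fun x : 'rV[R]_d => `|x|) @^-1` [set s | s < r]).
  by apply: open_comp => [y _|]; [exact: norm_continuous|exact: open_lt].
exact: (open_nbhs_nbhs (conj O xr)).
Qed.

Section Cover.
Variables (m : nat) (A : 'M['F_2]_m) (X : topologicalType) (p : 'rV[R]_m -> X).
Hypothesis Au : upper_triangular0 A.
Hypothesis pq : group_quotient A p.

Lemma gact_ball k (y y' : 'rV[R]_m) e : ball y e y' -> ball (gact A k y) e (gact A k y').
Proof.
move=> [e0 H]; split=> // i j; move: (H i j).
by rewrite (ord1 i) /ball /= gact_dist.
Qed.

Lemma gact_ball_eq k l (y : 'rV[R]_m) : ball (gact A k y) pi (gact A l y) -> k = l.
Proof. by move=> [_ H]; apply: (gact_separated Au (x := y)) => j; exact: (H ord0 j). Qed.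

Lemma fiber_ball_eq (y y' : 'rV[R]_m) : p y = p y' -> ball y pi y' -> y = y'.
Proof.
case: pq => _ _ _ fp /fp[k ->].
by rewrite -{1}(gact0 A y) => /gact_ball_eq <-; rewrite gact0.
Qed.

(** The constant is dictated by [lift_box], where two points of a fibre are joined by four
    displacements below pi/4 and must coincide, fibres being pi-separated. *)
Let pi4 : (0 : R) < pi / 4. Proof. by rewrite divr_gt0 // pi_gt0. Qed.

(** The group element carrying [c1 t] to [c2 t] is locally constant by separation, and by freeness
    it equals [k] at both of two nearby times or at neither. *)
Lemma deck_segment (c1 c2 : R -> 'rV[R]_m) k :
  (forall t : R, 0 <= t <= 1 -> {for t, continuous c1}) ->
  (forall t : R, 0 <= t <= 1 -> {for t, continuous c2}) ->
  (forall t : R, 0 <= t <= 1 -> p (c1 t) = p (c2 t)) ->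
  c2 0 = gact A k (c1 0) -> c2 1 = gact A k (c1 1).
Proof.
move=> cc1 cc2 pc.
apply: (@locally_constant_segment [set t | c2 t = gact A k (c1 t)]) => t t01.
have [l lP] : exists l, c2 t = gact A l (c1 t).
  by case: pq => _ _ _ fp; apply/fp; exact: pc.
have n1 : \forall t' \near t, ball (c1 t) (pi / 4) (c1 t').
  exact: (cc1 t t01 _ (nbhsx_ballx (c1 t) _ pi4)).
have n2 : \forall t' \near t, ball (c2 t) (pi / 4) (c2 t').
  exact: (cc2 t t01 _ (nbhsx_ballx (c2 t) _ pi4)).
apply: filterS2 n1 n2 => t' b1 b2 t'01 /=.
have [l' l'P] : exists l', c2 t' = gact A l' (c1 t').
  by case: pq => _ _ _ fp; apply/fp; exact: pc.
have ll : l' = l.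
  apply: (@gact_ball_eq _ _ (c1 t')); rewrite -l'P.
  apply: (@le_ball _ _ _ (pi / 4 + pi / 4)); first by have := pi_gt0 R; lra.
  apply: ball_triangle (ball_sym b2) _.
  by rewrite lP; apply: gact_ball.
rewrite l'P ll lP.
by split=> /(gact_free Au) ->.
Qed.

Section Lift.
Variables (d : nat) (g : 'rV[R]_d -> X).
Hypothesis gc : continuous g.

(** Compactness of the ball makes [e] uniform in [x]. It is uniform in the point [y] of the fibre
    because the group preserves coordinatewise distances, so one sheet can be moved onto all
    others. *)
Lemma lift_step (r : R) : exists2 e : R, 0 < e &
  forall x x' y, `|x| <= r -> ball x e x' -> p y = g x ->
    exists y', p y' = g x' /\ ball y (pi / 4) y'.
Proof.
case: pq => pc po ps fp.
have K : compact [set x : 'rV[R]_d | `|x| <= r].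
  apply: bounded_closed_compact.
    by exists r; split; [exact: num_real|move=> s rs x /= xr; exact: le_trans xr (ltW rs)].
  have -> : [set x : 'rV[R]_d | `|x| <= r] = (fun x => `|x|) @^-1` [set s | s <= r] by [].
  by apply: closed_comp => [x _|]; [exact: norm_continuous|exact: closed_le].
move/compact_near_coveringP: K => /(_ R (0 : R)^'+
  (fun e x => forall x' y, ball x e x' -> p y = g x ->
     exists y', p y' = g x' /\ ball y (pi / 4) y') _)[].
  move=> x0 _; have [y0 y0P] := ps (g x0).
  have pi8 : (0 : R) < pi / 8 by rewrite divr_gt0 // pi_gt0.
  have := po y0 _ (nbhsx_ballx y0 _ pi8); rewrite y0P => /gc /nbhs_ballP[e /= e0 eP].
  have e2 : 0 < e / 2 by rewrite divr_gt0.
  exists (ball x0 (e / 2), [set s | 0 < s < e / 2]).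
    split; first exact: nbhsx_ballx.
    near=> s; apply/andP; split; first by near: s; exact: nbhs_right_gt.
    by near: s; exact: nbhs_right_lt.
  move=> [x s] /= [x0x /andP[s0 se]] x' y xx' pyx.
  have [y1 y01 y1P] : (p @` ball y0 (pi / 8)) (g x).
    by apply: eP; apply: le_ball x0x; lra.
  have [y2 y02 y2P] : (p @` ball y0 (pi / 8)) (g x').
    apply: eP; have := ball_triangle x0x xx'; apply: le_ball; lra.
  have [k ->] : exists k, y = gact A k y1 by apply/fp; rewrite pyx.
  exists (gact A k y2); split.
    by rewrite -y2P; apply/esym/fp; exists k.
  apply: gact_ball; rewrite (_ : pi / 4 = pi / 8 + pi / 8); last by lra.
  exact: ball_triangle (ball_sym y01) y02.
move=> e /= e0 eP; exists (e / 2); first by rewrite divr_gt0.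
move=> x x' y xr; apply: (eP (e / 2)) => //=; rewrite ?divr_gt0 //.
by rewrite sub0r normrN gtr0_norm ?divr_gt0 //; lra.
Unshelve. all: by end_near. Qed.

(** The contraction x |-> s x joins a constant map to [g], and the lift is continued from s = n/N to
    (n+1)/N for all [x] at once. The new value is picked by choice near the old one; its continuity
    comes from uniqueness within distance pi. *)
Lemma lift_box (y0 : 'rV[R]_m) (r : R) : p y0 = g 0 -> 0 < r ->
  exists F : 'rV[R]_d -> 'rV[R]_m,
    [/\ F 0 = y0, forall x, `|x| < r -> p (F x) = g x &
        forall x, `|x| < r -> {for x, continuous F}].
Proof.
move=> py0 r0; have [e e0 eP] := lift_step r.
case: pq => pc po ps fp.
(* With this [N], one step moves every point of the ball by less than [e]. *)
pose N := (Num.truncn (r / e)).+1.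
have Ne : r / N%:R < e.
  rewrite ltr_pdivrMr ?ltr0n // mulrC -ltr_pdivrMr //.
  exact: truncnS_gt.
have N0 : (0 : R) < N%:R by rewrite ltr0n.
suff : forall n, (n <= N)%N -> exists F : 'rV[R]_d -> 'rV[R]_m,
    [/\ F 0 = y0, forall x, `|x| < r -> p (F x) = g ((n%:R / N%:R) *: x) &
        forall x, `|x| < r -> {for x, continuous F}].
  move=> /(_ N (leqnn N))[F [F0 Fp Fc]]; exists F; split=> // x xr.
  by rewrite Fp // divff ?gt_eqF // scale1r.
elim=> [|n IH] nN.
  exists (fun=> y0); split=> // [x _|x _]; first by rewrite mul0r scale0r.
  exact: cst_continuous.
have [F [F0 Fp Fc]] := IH (ltnW nN).
set s := n%:R / N%:R in Fp; set s' := n.+1%:R / N%:R.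
have s01 : 0 <= s <= 1.
  by rewrite divr_ge0 ?ler0n //= ler_pdivrMr // mul1r ler_nat ltnW.
have /choice[F' F'P] : forall x, exists y', `|x| < r ->
    p y' = g (s' *: x) /\ ball (F x) (pi / 4) y'.
  move=> x; have [xr|nxr] := pselect (`|x| < r); last by exists y0 => /nxr.
  have [] := eP (s *: x) (s' *: x) (F x); last 1 first.
  - by move=> y' y'P; exists y'.
  - rewrite normrZ ger0_norm; last by case/andP: s01.
    by apply: le_trans (ltW xr); rewrite ler_piMl //; case/andP: s01.
  - have ss : s' - s = N%:R^-1 by rewrite /s' /s -mulrBl -natrB // subSnn mul1r.
    rewrite -ball_normE /= distrC -scalerBl normrZ ss ger0_norm ?invr_ge0 ?ler0n //.
    by apply: le_lt_trans Ne; rewrite mulrC ler_pM2r ?invr_gt0 // ltW.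
  - exact: Fp.
exists F'; split.
- have [|+ +] := F'P 0; first by rewrite normr0.
  rewrite scaler0 -py0 F0 => pF' bF'; apply/esym/fiber_ball_eq => //.
  by apply: le_ball bF'; have := pi_gt0 R; lra.
- by move=> x /F'P[].
- move=> x xr U /= /nbhs_ballP[e1 /= e10 e1U].
  pose h := Num.min e1 (pi / 4).
  have h0 : 0 < h by rewrite lt_min e10.
  have [pF'x bF'x] := F'P x xr.
  have n1 : \forall x' \near x, (p @` ball (F' x) h) (g (s' *: x')).
    have c : {for x, continuous (fun x' : 'rV[R]_d => g (s' *: x'))}.
      apply: (@continuous_comp _ _ _ (fun x' : 'rV[R]_d => s' *: x') g).
        exact: scaler_continuous.
      exact: gc.
    by apply: c; rewrite -pF'x; apply: po; exact: nbhsx_ballx.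
  have n2 : \forall x' \near x, ball (F x) (pi / 4) (F x').
    exact: (Fc x xr _ (nbhsx_ballx _ _ pi4)).
  have n3 : \forall x' \near x, `|x'| < r.
    exact: norm_lt_near.
  change (\forall x' \near x, U (F' x')); near=> x'; apply: e1U.
  have [y'' by'' py''] : (p @` ball (F' x) h) (g (s' *: x')) by near: x'.
  have bFx : ball (F x) (pi / 4) (F x') by near: x'.
  have x'r : `|x'| < r by near: x'.
  have [pF'x' bF'x'] := F'P x' x'r.
  (* The point found near [F' x] by openness of [p] is the chosen one, as both lie in one fibre at
     distance below 4 * pi/4. *)
  have <- : y'' = F' x'.
    apply: fiber_ball_eq; first by rewrite py''.
    rewrite (_ : pi = pi / 4 + pi / 4 + pi / 4 + pi / 4); last by lra.
    apply: ball_triangle bF'x'; apply: ball_triangle bFx.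
    apply: ball_triangle (ball_sym bF'x).
    by apply: ball_sym; apply: le_ball by''; rewrite ge_min lexx orbT.
  by apply: le_ball by''; rewrite ge_min lexx.
Unshelve. all: by end_near. Qed.

Lemma lift_unique_segment (F1 F2 : 'rV[R]_d -> 'rV[R]_m) k x0 x :
  let c t := x0 + t *: (x - x0) in
  (forall t : R, 0 <= t <= 1 -> {for c t, continuous F1}) ->
  (forall t : R, 0 <= t <= 1 -> {for c t, continuous F2}) ->
  (forall t : R, 0 <= t <= 1 -> p (F1 (c t)) = p (F2 (c t))) ->
  F2 x0 = gact A k (F1 x0) -> F2 x = gact A k (F1 x).
Proof.
move=> c c1 c2 pc F0.
have c0 : c 0 = x0 by rewrite /c scale0r addr0.
have c1' : c 1 = x by rewrite /c scale1r subrKC.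
have cc (t : R) : {for t, continuous c}.
  exact: (cvgD (cvg_cst x0) (@scalel_continuous _ _ (x - x0) t)).
rewrite -c1'; apply: (@deck_segment (F1 \o c) (F2 \o c)) => [t t01|t t01|//|/=].
- by apply: continuous_comp; [exact: cc|exact: c1].
- by apply: continuous_comp; [exact: cc|exact: c2].
- by rewrite c0.
Qed.

Lemma lift_exists (y0 : 'rV[R]_m) : p y0 = g 0 ->
  exists F : 'rV[R]_d -> 'rV[R]_m,
    [/\ continuous F, F 0 = y0 & forall x, p (F x) = g x].
Proof.
move=> py0.
have /choice[F FP] : forall n : nat, exists F : 'rV[R]_d -> 'rV[R]_m,
    [/\ F 0 = y0, forall x, `|x| < n.+1%:R -> p (F x) = g x &
        forall x, `|x| < n.+1%:R -> {for x, continuous F}].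
  by move=> n; apply: lift_box; rewrite ?ltr0n.
(* The lifts on larger and larger balls agree by uniqueness, so letting the ball depend on [x] by an
   integer part does not break continuity. *)
pose b (x : 'rV[R]_d) := Num.truncn `|x|.
have bP x : `|x| < (b x).+1%:R by exact: truncnS_gt.
have agree n n' x : `|x| < n.+1%:R -> `|x| < n'.+1%:R -> F n x = F n' x.
  move=> xn xn'; have [F0 Fp Fc] := FP n; have [F0' Fp' Fc'] := FP n'.
  have seg (t : R) : 0 <= t <= 1 -> `|0 + t *: (x - 0)| <= `|x|.
    move=> /andP[t0 t1]; rewrite add0r subr0 normrZ ger0_norm //.
    by rewrite ler_piMl.
  rewrite -[RHS](gact0 A).
  apply: (@lift_unique_segment _ _ 0 0) => [t /seg t01|t /seg t01|t /seg t01|].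
  - by apply: Fc'; exact: (le_lt_trans t01 xn').
  - by apply: Fc; exact: (le_lt_trans t01 xn).
  - by rewrite (Fp _ (le_lt_trans t01 xn)) (Fp' _ (le_lt_trans t01 xn')).
  - by rewrite gact0 F0 F0'.
exists (fun x => F (b x) x); split.
- move=> x; have [F0 Fp Fc] := FP (b x).
  apply: near_eq_continuous (Fc x (bP x)).
  have : \forall x' \near x, `|x'| < (b x).+1%:R.
    exact: norm_lt_near.
  by apply: filterS => x' x'b; exact: agree.
- by have [] := FP (b 0).
- by move=> x; have [_ + _] := FP (b x); apply.
Qed.

End Lift.
End Cover.
End Lifting.

(** * Homeomorphisms induce isomorphisms of the deck groups *)

Section DeckIso.
Context {R : realType}.

Lemma lift_unique m (A : 'M['F_2]_m) (X : topologicalType) (p : 'rV[R]_m -> X) d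
    (F1 F2 : 'rV[R]_d -> 'rV[R]_m) k x0 :
  upper_triangular0 A -> group_quotient A p ->
  continuous F1 -> continuous F2 -> (forall x, p (F1 x) = p (F2 x)) ->
  F2 x0 = gact A k (F1 x0) -> forall x, F2 x = gact A k (F1 x).
Proof.
move=> Au pq c1 c2 pF F0 x.
by apply: (lift_unique_segment Au pq _ _ _ F0) => t _; [exact: c1|exact: c2|exact: pF].
Qed.

(** Both F o k and F lift the same map h o p, hence differ by one group element; freeness makes it
    multiplicative in [k]. *)
Lemma lift_equivariant m m' (A : 'M['F_2]_m) (B : 'M['F_2]_m')
    (X X' : topologicalType) (p : 'rV[R]_m -> X) (p' : 'rV[R]_m' -> X')
    (h : X -> X') (F : 'rV[R]_m -> 'rV[R]_m') :
  upper_triangular0 B -> group_quotient A p -> group_quotient B p' ->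
  continuous F -> (forall x, p' (F x) = h (p x)) ->
  exists2 phi : 'rV[int]_m -> 'rV[int]_m',
    (forall k l, phi (gmul A k l) = gmul B (phi k) (phi l)) &
    forall k x, F (gact A k x) = gact B (phi k) (F x).
Proof.
move=> Bu [pc po ps fp] pq' Fc pF.
have pg k x : p (gact A k x) = p x by apply/esym/fp; exists k.
have /choice[phi phiP] : forall k, exists l, forall x, F (gact A k x) = gact B l (F x).
  move=> k; case: (pq') => _ _ _ fp'.
  have [l lP] : exists l, F (gact A k 0) = gact B l (F 0).
    by apply/fp'; rewrite !pF pg.
  exists l; apply: (lift_unique Bu pq' Fc _ _ lP).
    by move=> x; apply: continuous_comp; [exact: gact_continuous|exact: Fc].
  by move=> x /=; rewrite !pF pg.
exists phi => // k l; apply: (gact_free Bu (x := F 0)).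
by rewrite -phiP !gactM phiP phiP.
Qed.

Lemma homeo_group_iso m m' (A : 'M['F_2]_m) (B : 'M['F_2]_m')
    (X X' : topologicalType) (p : 'rV[R]_m -> X) (p' : 'rV[R]_m' -> X')
    (h : X -> X') (h' : X' -> X) :
  upper_triangular0 A -> upper_triangular0 B ->
  group_quotient A p -> group_quotient B p' ->
  continuous h -> continuous h' -> cancel h h' -> cancel h' h ->
  exists phi psi,
    [/\ forall k l, phi (gmul A k l) = gmul B (phi k) (phi l),
        forall k l, psi (gmul B k l) = gmul A (psi k) (psi l),
        cancel phi psi & cancel psi phi].
Proof.
move=> Au Bu pq pq' hc hc' hK h'K.
case: (pq) => pc _ ps fp; case: (pq') => pc' _ ps' fp'.
have [y0 y0P] := ps' (h (p 0)).
have hpc : continuous (h \o p) by move=> x; apply: continuous_comp; [exact: pc|exact: hc].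
have hpc' : continuous (h' \o p') by move=> x; apply: continuous_comp; [exact: pc'|exact: hc'].
have [F [Fc F0 pF]] := lift_exists Bu pq' hpc y0P.
have [z0 z0P] := ps (h' (p' 0)).
have [G0 [G0c _ pG0]] := lift_exists Au pq hpc' z0P.
(* An arbitrary lift of [h'] inverts [F] only up to a deck transformation; composing with [k0] makes
   G F fix 0, so that it is the identity by uniqueness of lifts. *)
have [k0 k0P] : exists k, 0 = gact A k (G0 y0).
  by apply/fp; rewrite pG0 /= y0P hK.
pose G := gact A k0 \o G0.
have Gc : continuous G.
  by move=> x; apply: continuous_comp; [exact: G0c|exact: gact_continuous].
have pG x : p (G x) = h' (p' x).
  by rewrite -[RHS]pG0; apply/esym/fp; exists k0.
have GF x : G (F x) = x.
  rewrite -[RHS](gact0 A).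
  apply: (lift_unique (F1 := id) (F2 := G \o F) (x0 := 0) Au pq).
  - by move=> y; exact: cvg_id.
  - by move=> y; apply: continuous_comp; [exact: Fc|exact: Gc].
  - by move=> y /=; rewrite pG pF /= hK.
  - by rewrite /= gact0 F0 /G /= -k0P.
have FG x : F (G x) = x.
  rewrite -[RHS](gact0 B).
  apply: (lift_unique (F1 := id) (F2 := F \o G) (x0 := y0) Bu pq').
  - by move=> y; exact: cvg_id.
  - by move=> y; apply: continuous_comp; [exact: Gc|exact: Fc].
  - by move=> y /=; rewrite pF /= pG h'K.
  - by rewrite /= gact0 {1}/G /= -k0P F0.
have [phi phiM phiP] := lift_equivariant Bu pq pq' Fc pF.
have [psi psiM psiP] := lift_equivariant Au pq' pq Gc pG.
exists phi, psi; split=> // k.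
- by apply: (gact_free Au (x := G y0)); rewrite -psiP -[X in gact B _ X](FG y0) -phiP GF.
- by apply: (gact_free Bu (x := F 0)); rewrite -phiP -[X in gact A _ X](GF 0) -psiP FG.
Qed.

End DeckIso.

Lemma group_iso_compatible m m' (A : 'M['F_2]_m) (B : 'M['F_2]_m')
    (phi : 'rV[int]_m -> 'rV[int]_m') (psi : 'rV[int]_m' -> 'rV[int]_m) :
  upper_triangular0 A ->
  (forall k l, phi (gmul A k l) = gmul B (phi k) (phi l)) -> cancel phi psi ->
  forall Q, (forall k, par (psi k) = par k *m Q) ->
  exists2 P, (forall k, par (phi k) = par k *m P) & P *m Q = 1%:M.
Proof.
move=> Au phiM phiK Q QP.
have [|P PP] := hom_F2_linear Au (psi := fun k => par (phi k)).
  by move=> k l; rewrite phiM par_gmul.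
exists P => //; apply/row_matrixP => i.
by rewrite rowE -[delta_mx _ _]lift2K mulmxA -PP -QP phiK lift2K rowE mulmx1.
Qed.

Lemma group_iso_matrices m m' (A : 'M['F_2]_m) (B : 'M['F_2]_m')
    (phi : 'rV[int]_m -> 'rV[int]_m') (psi : 'rV[int]_m' -> 'rV[int]_m) :
  upper_triangular0 A -> upper_triangular0 B ->
  (forall k l, phi (gmul A k l) = gmul B (phi k) (phi l)) ->
  (forall k l, psi (gmul B k l) = gmul A (psi k) (psi l)) ->
  cancel phi psi -> cancel psi phi ->
  m = m' /\ exists P Q,
    [/\ P *m Q = 1%:M, forall k, par (phi k) = par k *m P &
        forall k, par (psi k) = par k *m Q].
Proof.
move=> Au Bu phiM psiM phiK psiK.
have [|Q QP] := hom_F2_linear Bu (psi := fun k => par (psi k)).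
  by move=> k l; rewrite psiM par_gmul.
have [P PP PQ] := group_iso_compatible Au phiM phiK QP.
have [Q' Q'P QP'] := group_iso_compatible Bu psiM psiK PP.
split; last by exists P, Q.
(* The matrices are a priori rectangular; one-sided inverses in both orders bound each size by the
   other. *)
by apply/eqP; rewrite eqn_leq (mulmx1_min PQ) (mulmx1_min QP').
Qed.

(** * Construction of the diffeomorphism *)

Section AffineMap.
Context {R : realType}.
Variables (n : nat) (A B P : 'M['F_2]_n).
Hypotheses (Bu : upper_triangular0 B) (Pu : P \in unitmx).

(* The coordinatewise description of the map of tori is
   z |-> (i^(c j) prod_i z_i^(D i j))_j. *)
Lemma affine_equivalence : compatible A B P ->
  exists (M N : 'M[R]_n) (b : 'rV[R]_n), [/\ M *m N = 1%:M, N *m M = 1%:M &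
    let H x := x *m M + b in
    forall x y, (exists k, y = gact A k x) <-> (exists l, H y = gact B l (H x))].
Proof.
move=> /choice[c cP].
(* Compatibility says precisely that [C] is supported where column [i] of [A] equals column [j] of
   [P *m B]; these columns serve as labels for the integral lift. *)
pose C := \matrix_(i, j) (P i j + c j * (P *m B) i j).
have Cu : C \in unitmx by exact: shear_unit.
have [|D [Du Dpar DE]] := unimodular_lift (a := fun i => col i A)
    (b := fun j => col j (P *m B)) Cu.
  by move=> i j; rewrite mxE; exact: cP.
pose M : 'M[R]_n := map_mx intr D; pose N : 'M[R]_n := map_mx intr (invmx D).
have MN : M *m N = 1%:M by rewrite -map_mxM mulmxV // map_mx1.
have NM : N *m M = 1%:M by rewrite -map_mxM mulVmx // map_mx1.
(* Where c_j = 1 and the sign is -1, the shift by pi/2 contributes an extra pi, which makes up for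
   the term c_j (P B) added to [P] in [C]. *)
pose half j : R := if c j == 0 then 0 else pi / 2.
pose b : 'rV[R]_n := \row_j half j.
exists M, N, b; split=> // H.
(* [L] is the induced map of groups: [corr] counts the extra half periods, and modulo 2 it cancels
   the term added in [C], so that [L k] has parity [par k *m P]. *)
pose corr (u : 'rV['F_2]_n) : 'rV[int]_n := lift2 (\row_j (c j * (u *m B) 0 j)).
pose L k := k *m D + corr (par k *m P).
have CE (u : 'rV['F_2]_n) j : (u *m C) 0 j = (u *m P) 0 j + c j * (u *m P *m B) 0 j.
  rewrite -mulmxA mxE [(u *m P) 0 j]mxE [(u *m (P *m B)) 0 j]mxE mulr_sumr -big_split /=.
  by apply: eq_bigr => i _; rewrite [C i j]mxE mulrDr mulrCA.
have HE k x : H (gact A k x) = gact B (L k) (H x).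
  have parL : par (L k) = par k *m P.
    rewrite parD parM Dpar lift2K; apply/rowP => j.
    by rewrite mxE CE [X in _ + X]mxE -addrA F2_addxx addr0.
  apply/rowP => j; rewrite [RHS]mxE /gsg parL -mulmxA.
  set a := (par k *m (P *m B)) 0 j.
  rewrite [H _ _ _]mxE [(_ *m M) _ _]mxE [b _ _]mxE [H x _ _]mxE [(x *m M) _ _]mxE [b _ _]mxE.
  rewrite [L k _ _]mxE [(k *m D) _ _]mxE [corr _ _ _]mxE [(\row__ _) _ _]mxE -mulmxA -/a.
  (* Wherever [D i j] is nonzero the labels agree, so all coordinates entering the sum carry the
     common sign [sg2 R a]. *)
  have -> : \sum_i gact A k x ord0 i * M i j =
      sg2 R a * (\sum_i x ord0 i * M i j) + pi * (\sum_i k ord0 i * D i j)%:~R.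
    rewrite rmorph_sum /= !mulr_sumr -big_split /=; apply: eq_bigr => i _.
    rewrite !mxE intrM; have [->|Dij] := eqVneq (D i j) 0; first by rewrite !mulr0 !addr0 ?mulr0.
    rewrite /gsg (_ : (par k *m A) 0 i = a); first by ring.
    have := congr1 (fun v : 'cV_n => (par k *m v) 0 0) (DE i j Dij).
    by rewrite -!col_mulmx mxE [in RHS]mxE.
  rewrite intrD /half; case: (F2_cases a) => ->; case: (F2_cases (c j)) => ->;
    rewrite ?sg2_0 ?sg2_1 ?mulr0 ?mul0r ?mulr1 ?eqxx ?oner_eq0 /=; by field.
have LS l : exists k, L k = l.
  (* The correction depends only on [par k *m P], which must be [par l]; it is therefore known in
     advance and can be subtracted before inverting [D]. *)
  pose u := (l - corr (par l)) *m invmx D; exists u.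
  have kD : u *m D = l - corr (par l) by rewrite mulmxKV.
  suff kP : par u *m P = par l by rewrite /L kD kP subrK.
  have parN (v : 'rV[int]_n) : par (- v) = par v.
    by rewrite /par map_mxN -[LHS]addr0 -(mx2_addxx (par v)) addKr.
  have : par u *m C = (par l *m invmx P) *m C.
    rewrite -[in LHS]Dpar -parM kD parD parN lift2K; apply/rowP => j.
    by rewrite CE mulmxKV // !mxE.
  move=> /(congr1 (mulmx^~ (invmx C))); rewrite /= !mulmxK // => ->.
  by rewrite mulmxKV.
have Hinj x y : H x = H y -> x = y.
  by move=> /addIr /(congr1 (mulmx^~ N)); rewrite /= -!mulmxA MN !mulmx1.
move=> x y; split=> [[k ->]|[l]]; first by exists (L k).
by have [k <-] := LS l; rewrite -HE => /Hinj ->; exists k.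
Qed.

End AffineMap.

(** * Descent of the affine map to a diffeomorphism *)

Section SmoothDescent.
Context {R : realType}.

Lemma tchart_is_chart n (x : 'rV[R]_n) : is_chart (tchart x).
Proof.
split.
- split; rewrite openE => z zP.
    exists (fun i j => [set w | 0 < rot_re (x ord0 j) w]) => [i j|w wP j]; last exact: wP.
    by rewrite (ord1 i); exact: (open_nbhs_nbhs (conj (@rot_re_gt0_open R _) (zP j))).
  exists (fun i j => ball (x ord0 j) (pi / 2)) => [i j|w wP j].
    rewrite (ord1 i); apply: (open_nbhs_nbhs (conj (ball_open _ _) _)).
    by move: (zP j); rewrite /= mxE /ball /= distrC.
  by move: (wP ord0 j); rewrite /= mxE /ball /= distrC.
- move=> z zP; split; last by rewrite tchart_cinv tchart_cdomK.
  by move=> j; rewrite /= !mxE; exact: rot_arg_near.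
- move=> y yP; rewrite tchart_cinv; split.
    by move=> j; move: (yP j); rewrite /= !mxE; exact: rot_re_expi_gt0.
  apply/rowP => j; rewrite !mxE rot_arg_expi //.
  by move: (yP j); rewrite /= !mxE.
- move=> z zP U [P xP PU].
  exists (fun i j => [set w | P ord0 j (rot_arg (x ord0 j) w)]) => [i j|w wP].
    rewrite (ord1 i); apply: (rot_arg_continuous (zP j)).
    by move: (xP ord0 j); rewrite !mxE.
  by apply: PU => i j; rewrite (ord1 i) !mxE; exact: wP.
- move=> y _.
  have -> : cinv (tchart x) = @expiv R n by apply/funext => z; rewrite tchart_cinv.
  exact: expiv_continuous.
Qed.

Lemma open_chart_domain n (S T : topologicalType) (c : chart R n S) (W : set S)
    (D : set T) (h : S -> T) :
  is_chart c -> open W -> (forall x, W x -> {for x, continuous h}) -> open D ->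
  open (cimg c `&` cinv c @^-1` (W `&` h @^-1` D)).
Proof.
move=> [[_ oi] _ _ _ ci] oW ch oD; rewrite openE => y [yi [Wy Dy]].
have n1 : \forall y' \near y, cimg c y' by exact: (open_nbhs_nbhs (conj oi yi)).
have n2 : \forall y' \near y, W (cinv c y').
  exact: (ci y yi _ (open_nbhs_nbhs (conj oW Wy))).
have n3 : \forall y' \near y, D (h (cinv c y')).
  exact: (continuous_comp (ci y yi) (ch _ Wy) (open_nbhs_nbhs (conj oD Dy))).
change (\forall y' \near y, (cimg c `&` cinv c @^-1` (W `&` h @^-1` D)) y').
by near=> y'; split; [|split]; near: y'.
Unshelve. all: by end_near. Qed.

(** Locally [f] is q' o expiv o H composed with a branch of the logarithm and a local inverse of
    [q]. The charts [tchart] have [expiv] as inverse, so the assumed smoothness of [q'] and of the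
    local inverse applies directly. *)
Lemma smooth_descends m n (M : chartedSpace R m) (N : chartedSpace R n)
    (q : torus R m -> M) (q' : torus R n -> N) (H : 'rV[R]_m -> 'rV[R]_n)
    (f : M -> N) :
  is_manifold M -> is_manifold N -> local_diffeo q -> local_diffeo q' ->
  (forall z, exists w, q w = z) -> Cinfty setT H ->
  (forall x, f (q (expiv x)) = q' (expiv (H x))) -> smooth f.
Proof.
move=> [_ _ Mc _ _] [_ _ Nc _ _] ql ql' qs HC fq.
have ps z : exists x, q (expiv x) = z.
  by have [w <-] := qs z; have [x <-] := expiv_surj w; exists x.
have Hc : continuous H by move=> x; exact: Ck_continuous (HC 0) I.
have po : open_map (q \o @expiv R m).
  by apply: open_map_comp (@expiv_open_map R m) (local_diffeo_open_map ql).
have cf z : {for z, continuous f}.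
  have [x <-] := ps z; move=> U fU.
  have c' : continuous (q' \o @expiv R n \o H).
    move=> t; apply: continuous_comp; first exact: Hc.
    by apply: continuous_comp; [exact: expiv_continuous|exact: local_diffeo_continuous].
  have n1 : nbhs x [set t | U (q' (expiv (H t)))].
    by apply: (c' x); rewrite /= -fq.
  apply: filterS (po x _ n1) => _ [t Ut <-].
  by rewrite /= fq.
split=> // c d ca da k.
apply/Ck_pointwise => y [yi [_ yd]].
have [x0 px0] := ps (cinv c y).
have [W [g [[oW Wx] oqW _ [gc gs] gq]]] := ql (expiv x0).
have [W' [g' [[oW' Wx'] _ [qc' qs'] _ _]]] := ql' (expiv (H x0)).
have [[ted _] _ _ _ _] := tchart_is_chart x0.
have [[dd _] _ _ _ _] := Nc d da.
set S1 := cimg c `&` cinv c @^-1` (q @` W `&` g @^-1` cdom (tchart x0)).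
have oS1 : open S1 by apply: open_chart_domain => //; exact: Mc.
set S2 := cimg (tchart (H x0)) `&`
  cinv (tchart (H x0)) @^-1` (W' `&` q' @^-1` cdom d).
have oS2 : open S2 by apply: open_chart_domain => //; exact: tchart_is_chart.
pose u := cmap (tchart x0) \o g \o cinv c.
have Cu : Ck k S1 u by exact: (gs c (tchart x0) ca (tchart_atlas x0) k).
have Cv : Ck k S2 (cmap d \o q' \o cinv (tchart (H x0))).
  exact: (qs' _ d (tchart_atlas (H x0)) da k).
have oS2H : open (H @^-1` S2) by apply: open_comp => // t _; exact: Hc.
have gy : g (cinv c y) = expiv x0 by rewrite -px0 gq.
have uy : u y = x0 by rewrite -[LHS]/(cmap (tchart x0) (g (cinv c y))) gy tchart_cmapK.
have S1y : S1 y.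
  split=> //; split; first by exists (expiv x0).
  by rewrite /= gy; exact: tchart_cdom.
(* The neighbourhood of [y] on which the local inverse, the logarithm and both charts are all
   defined. *)
pose V := S1 `&` u @^-1` (H @^-1` S2).
have Vy : V y.
  split=> //; rewrite /= uy; split; first exact: tchart_cimg.
  change ((W' `&` q' @^-1` cdom d) (cinv (tchart (H x0)) (H x0))).
  by rewrite tchart_cinv; split=> //; rewrite /= -fq px0.
have oV : open V.
  rewrite openE => z [S1z uz].
  have n1 : \forall z' \near z, S1 z' by exact: (open_nbhs_nbhs (conj oS1 S1z)).
  have n2 : \forall z' \near z, S2 (H (u z')).
    exact: (Ck_continuous Cu S1z (open_nbhs_nbhs (conj oS2H uz))).
  change (\forall z' \near z, V z').
  by near=> z'; split; near: z'.
have CV : Ck k V (cmap d \o q' \o cinv (tchart (H x0)) \o (H \o u)).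
  apply: (Ck_comp oV oS2 _ _ Cv); first by move=> z [].
  apply: (Ck_comp oV openT _ _ (HC k)) => //.
  by apply: Ck_sub Cu => z [].
apply: (@Ck_sub _ _ _ _ _ V); first by move=> _ ->.
apply: (eq_Ck oV) CV => z [[zi [qWz zd]] _].
change (cmap d (q' (cinv (tchart (H x0)) (H (u z)))) = cmap d (f (cinv c z))).
have [w Ww qw] := qWz.
have uz : expiv (u z) = g (cinv c z) := tchart_cdomK zd.
by rewrite tchart_cinv -fq uz -qw gq.
Unshelve. all: by end_near. Qed.

Lemma compatible_diffeomorphic n (A B P : 'M['F_2]_n) (M N : chartedSpace R n)
    (q : torus R n -> M) (q' : torus R n -> N) :
  is_manifold M -> is_manifold N ->
  upper_triangular0 A -> upper_triangular0 B ->
  is_bott_quotient A q -> is_bott_quotient B q' ->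
  P \in unitmx -> compatible A B P -> diffeomorphic M N.
Proof.
move=> Mm Nm Au Bu qA qB Pu cP.
have [M1 [N1 [b [MN NM HE]]]] := affine_equivalence (R := R) Bu Pu cP.
pose H x := x *m M1 + b; pose H' y := y *m N1 + (- (b *m N1)).
have HK x : H' (H x) = x by rewrite /H' /H mulmxDl -mulmxA MN mulmx1 addrK.
have H'K y : H (H' y) = y.
  by rewrite /H' /H mulmxDl mulNmx -!mulmxA NM !mulmx1 subrK.
have [_ _ ps fp] := bott_group_quotient Au qA.
have [_ _ ps' fp'] := bott_group_quotient Bu qB.
have /choice[s sP] := ps; have /choice[s' s'P] := ps'.
have [ql qs _] := qA; have [ql' qs' _] := qB.
(* The sections [s] and [s'] are arbitrary choices of preimages; equivariance of the affine map in
   both directions makes [f] and [g] independent of them. *)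
pose f z := q' (expiv (H (s z))); pose g w := q (expiv (H' (s' w))).
have fE x : f (q (expiv x)) = q' (expiv (H x)).
  by apply/fp'/HE/fp; exact: sP.
have gE y : g (q' (expiv y)) = q (expiv (H' y)).
  by apply/fp/HE; rewrite -/(H _) -/(H _) !H'K; apply/fp'; exact: s'P.
exists f, g; split.
- by apply: (smooth_descends Mm Nm ql ql' qs _ fE) => k; exact: Ck_affine.
- by apply: (smooth_descends Nm Mm ql' ql qs' _ gE) => k; exact: Ck_affine.
- by move=> z; rewrite /f gE HK; exact: sP.
- by move=> w; rewrite /g fE H'K; exact: s'P.
Qed.

Lemma diffeomorphic_sym m n (M : chartedSpace R m) (N : chartedSpace R n) :
  diffeomorphic M N -> diffeomorphic N M.
Proof. by move=> [f [g [sf sg fg gf]]]; exists g, f. Qed.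

End SmoothDescent.

Theorem corollary1p4 (R : realType) (n n' : nat)
    (M : chartedSpace R n) (M' : chartedSpace R n') :
  real_bott_manifold M -> real_bott_manifold M' ->
  diffeomorphic (prod_space circle M) (prod_space circle M') ->
  diffeomorphic M M'.
Proof.
move=> [Mm [A [Au [q qA]]]] [Mm' [B [Bu [q' qB]]]] [h [h' [[hc _] [hc' _] hK h'K]]].
have pA := circle_prod_group_quotient (bott_group_quotient Au qA).
have pB := circle_prod_group_quotient (bott_group_quotient Bu qB).
have Au' := upper_triangular0_block Au; have Bu' := upper_triangular0_block Bu.
have [phi [psi [phiM psiM phiK psiK]]] := homeo_group_iso Au' Bu' pA pB
  (fun x => hc x I) (fun x => hc' x I) hK h'K.
have [nn' [P [Q [PQ PP QP]]]] := group_iso_matrices Au' Bu' phiM psiM phiK psiK.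
have {}nn' : n = n' by move/eqP: nn'; rewrite eqn_add2l => /eqP.
subst n'.
have cP := hom_compatible Au' phiM PP; have cQ := hom_compatible Bu' psiM QP.
have [P1 [P1u [c1|c1]]] := cancel_compatible Au Bu PQ cP cQ.
  exact: (compatible_diffeomorphic Mm Mm' Au Bu qA qB P1u c1).
apply: diffeomorphic_sym.
exact: (compatible_diffeomorphic Mm' Mm Bu Au qB qA P1u c1).
Qed.
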